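(* Let $n\ge 2$, let $W\subset\mathbb{R}^n$ be a connected open set and let $X=(X_1,\dots,X_m)$ be $C^\infty$ real vector fields on $W$ satisfying Hörmander's condition in $W$. Let $\Omega\subset\subset W$ be a bounded connected open subset whose boundary $\partial\Omega$ is smooth and non-characteristic for $X$, and suppose that the Hörmander index $Q$ of $\overline{\Omega}$ with respect to $X$ satisfies $Q\ge 2$. Let $\lambda_k$ be the $k$-th Dirichlet eigenvalue of $-\triangle_X$ on $\Omega$. Then there is a constant $\tilde C>0$ depending on $X$ and $\Omega$ such that $$\lambda_k\le\tilde C\cdot(k-1)^{\frac2n}+\lambda_1\qquad\text{for all }k\ge1.$$
   Context: Hörmander's condition: $X_1,\dots,X_m$ together with their commutators up to a certain fixed length span the tangent space at each point of $W$. The Hörmander index $Q$ of $\overline\Omega$ is the (smallest) integer such that $X_1,\dots,X_m$ together with their commutators of length at most $Q$ span $T_x(W)$ at each $x\in\overline\Omega$ (a single $X_j$ has length 1). $\partial\Omega$ is non-characteristic for $X$ if for every $x_0\in\partial\Omega$ there is $j_0$ with $X_{j_0}(x_0)\notin T_{x_0}(\partial\Omega)$. Function spaces and operator: $H^1_X(W)=\{u\in L^2(W): X_ju\in L^2(W),\ 1\le j\le m\}$ with norm $\|u\|^2_{H^1_X(W)}=\|u\|^2_{L^2(W)}+\sum_{j=1}^m\|X_ju\|^2_{L^2(W)}$, and $H^1_{X,0}(\Omega)$ is the closure of $C_0^\infty(\Omega)$ in $H^1_X(W)$. $X_i^*$ is the formal adjoint of $X_i$ with respect to Lebesgue measure,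 $\triangle_X=-\sum_{i=1}^mX_i^*X_i$, and $-\triangle_X$ denotes the self-adjoint operator on $L^2(\Omega)$ with domain $\{u\in H^1_{X,0}(\Omega):\triangle_Xu\in L^2(\Omega)\}$. It has discrete spectrum $0<\lambda_1\le\lambda_2\le\cdots$, $\lambda_k\to+\infty$ (counted with multiplicity); these are the Dirichlet eigenvalues. *)

(* Defs.v *)
From HB Require Import structures.
From mathcomp Require Import all_boot all_order all_algebra.
From mathcomp Require Import all_classical all_reals all_analysis.

Set Implicit Arguments.
Unset Strict Implicit.
Unset Printing Implicit Defensive.

Import Order.TTheory GRing.Theory Num.Theory.
Import numFieldNormedType.Exports.

Local Open Scope classical_set_scope.
Local Open Scope ring_scope.

Fact rV_display : measure_display.
Proof. exact: default_measure_display. Qed.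

(* R^n is equipped with the sigma-algebra generated by the coordinates, i.e.,
   its Borel sigma-algebra. *)
Section measurable_rV.
Context (R : realType) (n : nat).

Definition rV_coor (i : 'I_n) (x : 'rV[R]_n) : measurableTypeR R := x ord0 i.

Let rV_set0 : g_sigma_preimage rV_coor set0.
Proof. exact: sigma_algebra0. Qed.

Let rV_setC A : g_sigma_preimage rV_coor A -> g_sigma_preimage rV_coor (~` A).
Proof. exact: sigma_algebraC. Qed.

Let rV_bigcup (F : _^nat) : (forall i, g_sigma_preimage rV_coor (F i)) ->
  g_sigma_preimage rV_coor (\bigcup_i (F i)).
Proof. exact: sigma_algebra_bigcup. Qed.

HB.instance Definition _ := @isMeasurable.Build rV_display
  'rV[R]_n (g_sigma_preimage rV_coor) rV_set0 rV_setC rV_bigcup.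

End measurable_rV.

Section measurable_fun_rV.
Context d (T : measurableType d) (R : realType).

Lemma measurable_rV_coor n (i : 'I_n) :
  measurable_fun [set: 'rV[R]_n] (@rV_coor R n i).
Proof.
move=> _ Y mY; rewrite setTI; apply: sub_sigma_algebra => /=.
rewrite -bigcup_seq/=; exists i => /=; first by rewrite mem_index_enum.
by exists Y => //; rewrite setTI.
Qed.

Lemma measurable_fun_rVP n (f : T -> 'rV[R]_n) :
  (forall i, measurable_fun [set: T] (@rV_coor R n i \o f)) ->
  measurable_fun [set: T] f.
Proof.
move=> mf.
suff : g_sigma_preimage (fun i => @rV_coor R n i \o f) `<=` measurable.
  rewrite g_sigma_preimage_comp => prefS _ A mA; apply: prefS.
  by exists A.
apply: smallest_sub; first exact: sigma_algebra_measurable.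
case: n => [|n] in f mf *; first by rewrite big_ord0.
rewrite -bigcup_mkord_ord; apply: bigcup_sub => i Ii.
by move=> A [B mB <-]; exact: mf.
Qed.

End measurable_fun_rV.

(* Restated because the canonical sigma-finite structure of [m1 \x m2] is not
   inferred: it is shadowed by the one for subprobabilities. *)
Lemma product_measure1_sigma_finite d1 d2 (T1 : measurableType d1)
    (T2 : measurableType d2) (R : realType)
    (m1 : {sigma_finite_measure set T1 -> \bar R})
    (m2 : {sigma_finite_measure set T2 -> \bar R}) :
  sigma_finite setT (m1 \x m2)%E.
Proof.
have /sigma_finiteP[F [TF ndF Foo]] := sigma_finiteT m1.
have /sigma_finiteP[G [TG ndG Goo]] := sigma_finiteT m2.
exists (fun n => F n `*` G n).
  rewrite -setXTT TF TG predeqE => -[x y]; split.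
    move=> [/= [n _ Fnx] [k _ Gky]]; exists (maxn n k) => //; split.
    - by move: x Fnx; exact/subsetPset/ndF/leq_maxl.
    - by move: y Gky; exact/subsetPset/ndG/leq_maxr.
  by move=> [n _ []/= ? ?]; split; exists n.
move=> k; have [? ?] := Foo k; have [? ?] := Goo k.
split; first exact: measurableX.
by rewrite product_measure1E// lte_mul_pinfty// ge0_fin_numE.
Qed.

Section lebesgue_rV_succ.
Context (R : realType) (n : nat).
Local Notation RT := (measurableTypeR R).

Definition cons_rV (p : RT * 'rV[R]_n) : 'rV[R]_n.+1 :=
  \row_i (if unlift ord0 i is Some j then p.2 ord0 j else (p.1 : R)).

Definition uncons_rV (x : 'rV[R]_n.+1) : RT * 'rV[R]_n :=
  (x ord0 ord0, \row_j x ord0 (lift ord0 j)).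

Lemma cons_rVK : cancel cons_rV uncons_rV.
Proof.
case=> x v; rewrite /uncons_rV /cons_rV mxE unlift_none/=; congr pair.
by apply/rowP => j; rewrite !mxE liftK.
Qed.

Lemma uncons_rVK : cancel uncons_rV cons_rV.
Proof. by move=> x; apply/rowP => i; rewrite mxE; case: unliftP => [j|] -> //=; rewrite mxE. Qed.

Lemma measurable_cons_rV : measurable_fun [set: RT * 'rV[R]_n] cons_rV.
Proof.
apply: measurable_fun_rVP => i; rewrite (_ : _ \o _ = fun p : RT * 'rV[R]_n =>
  if unlift ord0 i is Some j then @rV_coor R n j p.2 else p.1); last first.
  by apply/funext => p; rewrite /= /rV_coor mxE.
case: unliftP => [j _|_]; last exact: measurable_fst.
exact: (measurableT_comp (measurable_rV_coor j) measurable_snd).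
Qed.

Lemma measurable_uncons_rV : measurable_fun [set: 'rV[R]_n.+1] uncons_rV.
Proof.
apply: measurable_fun_pair; first exact: (measurable_rV_coor (@ord0 n)).
apply: measurable_fun_rVP => j.
rewrite (_ : _ \o _ = @rV_coor R n.+1 (lift ord0 j)).
  exact: measurable_rV_coor.
by apply/funext => x; rewrite /= /rV_coor mxE.
Qed.

Variable mu : {sigma_finite_measure set 'rV[R]_n -> \bar R}.

Definition lebesgue_rV_succ : set 'rV[R]_n.+1 -> \bar R :=
  pushforward (lebesgue_measure \x mu)%E cons_rV.

Let lebesgue_rV_succ0 : lebesgue_rV_succ set0 = 0%E.
Proof. by rewrite /lebesgue_rV_succ /pushforward preimage_set0 measure0. Qed.

Let lebesgue_rV_succ_ge0 A : (0 <= lebesgue_rV_succ A)%E.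
Proof. exact: (measure_ge0 (lebesgue_measure \x mu)%E). Qed.

Let lebesgue_rV_succ_sigma_additive : semi_sigma_additive lebesgue_rV_succ.
Proof.
move=> F mF tF mUF; rewrite /lebesgue_rV_succ /pushforward preimage_bigcup.
have mcons A : measurable A -> measurable (cons_rV @^-1` A).
  by move=> mA; rewrite -[X in measurable X]setTI; exact: measurable_cons_rV.
apply: measure_semi_sigma_additive.
- by move=> k; exact: mcons.
- apply/trivIsetP => /= i j _ _ ij; rewrite -preimage_setI.
  by move/trivIsetP : tF => /(_ _ _ _ _ ij) ->//; rewrite preimage_set0.
- by rewrite -preimage_bigcup; exact: mcons.
Qed.

HB.instance Definition _ := isMeasure.Build _ _ _ lebesgue_rV_succ
  lebesgue_rV_succ0 lebesgue_rV_succ_ge0 lebesgue_rV_succ_sigma_additive.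

Let lebesgue_rV_succ_sigma_finite : sigma_finite setT lebesgue_rV_succ.
Proof.
have [F TF Foo] := product_measure1_sigma_finite (@lebesgue_measure R) mu.
exists (fun i => uncons_rV @^-1` F i).
  by rewrite -preimage_bigcup -TF preimage_setT.
move=> i; have [mF Fi] := Foo i; split.
  by rewrite -[X in measurable X]setTI; exact: measurable_uncons_rV.
rewrite /lebesgue_rV_succ /pushforward -comp_preimage.
by rewrite (_ : uncons_rV \o cons_rV = id)//; apply/funext => x /=; exact: cons_rVK.
Qed.

HB.instance Definition _ := @Measure_isSigmaFinite.Build _ _ _
  lebesgue_rV_succ lebesgue_rV_succ_sigma_finite.

End lebesgue_rV_succ.

(* Lebesgue measure on R^n = R x R^(n-1), as an iterated product measure. *)
Fixpoint lebesgue_rV (R : realType) (n : nat) :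
    {sigma_finite_measure set 'rV[R]_n -> \bar R} :=
  match n with
  | 0 => \d_(0 : 'rV[R]_0)
  | n'.+1 => lebesgue_rV_succ (lebesgue_rV R n')
  end.

Lemma lebesgue_rV0 (R : realType) : lebesgue_rV R 0 setT = 1%E.
Proof. by rewrite /= diracE mem_set. Qed.

Lemma lebesgue_rVS (R : realType) (n : nat) (A : set (measurableTypeR R))
    (B : set 'rV[R]_n) : measurable A -> measurable B ->
  lebesgue_rV R n.+1
    [set x | A (x ord0 ord0) /\ B (\row_j x ord0 (lift ord0 j))] =
  (lebesgue_measure A * lebesgue_rV R n B)%E.
Proof.
move=> mA mB; rewrite /= /lebesgue_rV_succ /pushforward.
rewrite -product_measure1E//; congr (product_measure1 _ _ _).
apply/seteqP; split=> -[x v] /=; have := cons_rVK (x, v);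
  by rewrite /uncons_rV => -[-> ->].
Qed.

Section smoothness.
Context {R : realType} {n : nat}.
Local Notation E := 'rV[R]_n.
Implicit Types (W S : set E) (Y Z : E -> E) (phi : E -> R).

Definition partial (i : 'I_n) (f : E -> R) : E -> R :=
  'D_(delta_mx ord0 i) f.

Definition iter_partial (s : seq 'I_n) (f : E -> R) : E -> R :=
  foldr partial f s.

(* C^oo on an open set [W]: partial derivatives of all orders exist and are
   continuous at the points of [W]. *)
Definition smooth_on W (f : E -> R) :=
  forall (s : seq 'I_n) x, W x ->
    {for x, continuous (iter_partial s f)} /\
    forall i, derivable (iter_partial s f) x (delta_mx ord0 i).

(* C_0^oo(W) *)
Definition test_function W phi :=
  [/\ smooth_on setT phi, compact (closure [set x | phi x != 0]) &
      closure [set x | phi x != 0] `<=` W].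

Definition smooth_vector_field W Y :=
  forall k, smooth_on W (fun x => Y x ord0 k).

Definition vf_apply Y phi : E -> R := fun x => 'D_(Y x) phi x.

(* Formal adjoint of Y = \sum_k Y_k d_k with respect to Lebesgue measure:
   Y^* phi = - \sum_k d_k (Y_k phi). *)
Definition vf_adjoint Y phi : E -> R :=
  fun x => - \sum_(k < n) partial k (fun y => Y y ord0 k * phi y) x.

Definition lie_bracket Y Z : E -> E := fun x => 'D_(Y x) Z x - 'D_(Z x) Y x.

Definition bdry S : set E := closure S `\` S°.

(* [S] is locally, near each of its boundary points, one side of a regular
   level set. *)
Definition smooth_boundary S :=
  forall x, bdry S x -> exists (U : set E) (rho : E -> R),
    [/\ open U /\ U x,
        smooth_on U rho,
        forall y, U y -> exists i, partial i rho y != 0,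
        S `&` U = [set y | U y /\ rho y < 0] &
        bdry S `&` U = [set y | U y /\ rho y = 0]].

(* Velocities at time 0 of the curves contained in [S] and passing through [x];
   when [S] is an embedded C^oo hypersurface, asking for smooth curves yields
   the same set. *)
Definition tangent_space S (x : E) : set E :=
  [set v | exists gamma : R -> E,
    [/\ gamma 0 = x, \forall t \near 0, S (gamma t)
      & is_derive (0 : R) (1 : R) gamma v]].

End smoothness.

Section hormander.
Context {R : realType} {n m : nat}.
Local Notation E := 'rV[R]_n.
Implicit Types (X : 'I_m -> E -> E) (K W : set E).

(* [commutator X [:: j1; ...; jk]] is [X_j1, [X_j2, ... [X_j(k-1), X_jk]...]],
   of length k; the empty word is sent to the null vector field, which does not
   contribute to spans. *)
Fixpoint commutator X (s : seq 'I_m) : E -> E :=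
  match s with
  | [::] => fun=> 0
  | [:: j] => X j
  | j :: s' => lie_bracket (X j) (commutator X s')
  end.

Definition spans_upto X (r : nat) (x : E) :=
  (<<[seq commutator X s x | s : r.-bseq 'I_m]>> = fullv)%VS.

Definition hormander_condition X W :=
  exists r, forall x, W x -> spans_upto X r x.

Definition hormander_index X K (Q : nat) :=
  (forall x, K x -> spans_upto X Q x) /\
  (forall q, (forall x, K x -> spans_upto X q x) -> (Q <= q)%N).

Definition non_characteristic X S :=
  forall x, bdry S x -> exists j, ~ tangent_space (bdry S) x (X j x).

End hormander.

Section dirichlet.
Context {R : realType} {n m : nat}.
Local Notation E := 'rV[R]_n.
Local Notation leb := (lebesgue_rV R n).
Variables (X : 'I_m -> E -> E) (W Omega : set E).
Implicit Types (D : set E) (u f g : E -> R) (mu : R).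

Definition sqnorm D u : \bar R := (\int[leb]_(x in D) (u x ^+ 2)%:E)%E.

Definition L2 D u := measurable_fun D u /\ (sqnorm D u < +oo)%E.

(* Y u = g in the sense of distributions on [D] *)
Definition weak_derivative D (Y : E -> E) u g :=
  forall phi, test_function D phi ->
    \int[leb]_(x in D) (g x * phi x) =
    \int[leb]_(x in D) (u x * vf_adjoint Y phi x).

(* [u] belongs to H^1_X(D), with X_j u = g_j *)
Definition H1X D u (g : 'I_m -> E -> R) :=
  L2 D u /\ forall j, L2 D (g j) /\ weak_derivative D (X j) u (g j).

(* squared H^1_X(D)-norm of [u] when X_j u = g_j *)
Definition H1X_sqnorm D u (g : 'I_m -> E -> R) : \bar R :=
  (sqnorm D u + \sum_(j < m) sqnorm D (g j))%E.

(* closure of C_0^oo(Omega) in H^1_X(W) *)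
Definition H1X0 u :=
  exists2 g, H1X W u g &
    forall eps : R, 0 < eps -> exists2 phi, test_function Omega phi &
      (H1X_sqnorm W (fun x => u x - phi x)%R
        (fun j x => g j x - vf_apply (X j) phi x)%R < eps%:E)%E.

(* \sum_i X_i^* X_i, which is formally self-adjoint *)
Definition sum_adj_sq (phi : E -> R) : E -> R :=
  fun x => \sum_(i < m) vf_adjoint (X i) (vf_apply (X i) phi) x.

(* - \triangle_X u = f in the sense of distributions on [Omega] *)
Definition weak_neg_laplacian u f :=
  forall phi, test_function Omega phi ->
    \int[leb]_(x in Omega) (f x * phi x) =
    \int[leb]_(x in Omega) (u x * sum_adj_sq phi x).

(* Graph of the operator - \triangle_X of L^2(Omega). Elements of L^2(Omega)
   are represented by functions, whose values outside [Omega] are irrelevant;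
   an element of H^1_{X,0}(Omega) vanishes a.e. on W \ Omega. *)
Definition dirichlet_operator u f :=
  [/\ H1X0 u, L2 Omega f & weak_neg_laplacian u f].

Definition resolvent_set : set R := [set mu |
  (forall f, L2 Omega f ->
     exists u, dirichlet_operator u (fun x => f x + mu * u x)) /\
  (exists C : R, forall u f, dirichlet_operator u f ->
     (sqnorm Omega u <= C%:E * sqnorm Omega (fun x => f x - mu * u x)%R)%E)].

Definition dirichlet_spectrum : set R := ~` resolvent_set.

Definition eigenspace_of mu : set (E -> R) :=
  [set u | dirichlet_operator u (fun x => mu * u x)].

(* The classes modulo a.e. equality on [Omega] of the elements of [V] form a
   vector space of dimension [d]. *)
Definition has_dim (V : set (E -> R)) (d : nat) :=
  exists e : 'I_d -> E -> R,
    [/\ forall i, V (e i),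
        forall c : 'I_d -> R,
          {ae leb, forall x, Omega x -> \sum_(i < d) c i * e i x = 0} ->
          forall i, c i = 0 &
        forall u, V u -> exists c : 'I_d -> R,
          {ae leb, forall x, Omega x -> u x = \sum_(i < d) c i * e i x}].

(* [lam 0], [lam 1], ... are the Dirichlet eigenvalues lambda_1, lambda_2, ...:
   the spectrum is discrete, made of the [lam k], and every real number occurs
   in [lam] as many times as the dimension of the corresponding eigenspace. *)
Definition dirichlet_eigenvalues (lam : nat -> R) :=
  [/\ 0 < lam 0%N,
      {homo lam : i j / (i <= j)%N >-> i <= j},
      lam k @[k --> \oo] --> +oo,
      dirichlet_spectrum = range lam &
      forall mu, exists2 d, ([set k | lam k = mu] #= `I_d)%card &
        has_dim (eigenspace_of mu) d].

End dirichlet.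

(* Main.v *)
From HB Require Import structures.
Require Import Defs.
From mathcomp Require Import all_boot all_order all_algebra.
From mathcomp Require Import all_classical all_reals all_analysis.
From mathcomp Require Import measurable_realfun ring lra.

Set Implicit Arguments.
Unset Strict Implicit.
Unset Printing Implicit Defensive.

Import Order.TTheory GRing.Theory Num.Theory.
Import numFieldNormedType.Exports.

Local Open Scope classical_set_scope.
Local Open Scope ring_scope.

(** Upper bounds for eigenvalues come from the min-max principle: lambda_k is
   at most the largest Rayleigh quotient on any k-dimensional space of test
   functions. A cube contained in Omega splits into N^n disjoint cubes whose
   radius r is of order 1/N. One bump function, translated and dilated, gives
   a test function in each of them. As their supports are disjoint, these
   functions are orthogonal to each other, in L^2 as well as for the energy
   \sum_j |X_j phi|^2; and as the X_j are first-order operators whose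
   coefficients are bounded on Omega, their Rayleigh quotients are at most
   A / r^2 ([small_bump_rayleigh]), hence so is lambda_k if k <= N^n. For
   k >= 2, the least such N satisfies N <= 2 (N - 1) and (N - 1)^n <= k - 1,
   so that N^2 <= 4 (k - 1)^(2/n) ([least_grid_size]). For k = 1 the bound
   is an equality.

   The spectrum is given through the resolvent set and the dimensions of the
   eigenspaces, and the min-max principle is derived from these. Let A be a
   symmetric operator.
   - If (mu - h, mu + h) lies in the resolvent set, then
     |(A - mu) u| >= h |u| ([resolvent_gap]).
   - Letting mu tend to -oo, A >= lambda_1 ([bottom_of_spectrum]).
   - If A >= s on an invariant subspace K and (s, s') lies in the resolvent
     set, then A >= s' on the part of K orthogonal to the kernel of A - s
     ([next_eigenvalue]). This is proved first on the range of A - s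
     ([range_ge]). To see that this range is dense in the orthogonal of the
     kernel, iterate s A^-1, whose powers converge geometrically to the
     projection on the kernel ([iterates_cvg0]).
   By induction, A >= lambda_k on the orthogonal of the eigenspaces below
   lambda_k ([rayleigh_lower_bound]). These have total dimension less than k,
   so a k-dimensional space of test functions meets that orthogonal
   ([minmax_upper]).

   The Dirichlet operator fits this setting: L^2(Omega) is complete
   ([L2_complete]), the operator is symmetric by Green's formula on the
   closure of the test functions ([energy_identity]), and its domain contains
   the test functions, by integration by parts ([test_weak_derivative]). *)

(** * Semi-inner products *)

Section semi_inner_product.
Context (R : realType) (H : lmodType R) (ip : H -> H -> R).
Hypothesis ip_linear : forall a u v w, ip (a *: u + v) w = a * ip u w + ip v w.
Hypothesis ip_sym : forall u v, ip u v = ip v u.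

Lemma ipDl u v w : ip (u + v) w = ip u w + ip v w.
Proof. by have := ip_linear 1 u v w; rewrite scale1r mul1r. Qed.

Lemma ip0l w : ip 0 w = 0.
Proof. by have := ipDl 0 0 w; rewrite addr0; lra. Qed.

Lemma ipZl a u w : ip (a *: u) w = a * ip u w.
Proof. by have := ip_linear a u 0 w; rewrite addr0 ip0l addr0. Qed.

Lemma ipNl u w : ip (- u) w = - ip u w.
Proof. by rewrite -scaleN1r ipZl mulN1r. Qed.

Lemma ipDr u v w : ip u (v + w) = ip u v + ip u w.
Proof. by rewrite ip_sym ipDl !(ip_sym u). Qed.

Lemma ipZr a u w : ip u (a *: w) = a * ip u w.
Proof. by rewrite ip_sym ipZl (ip_sym u). Qed.

Lemma ipNr u w : ip u (- w) = - ip u w.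
Proof. by rewrite ip_sym ipNl (ip_sym u). Qed.

Definition ipE := (ipDl, ipDr, ipZl, ipZr, ipNl, ipNr).

Lemma ip_suml (I : Type) (r : seq I) (P : pred I) (F : I -> H) w :
  ip (\sum_(i <- r | P i) F i) w = \sum_(i <- r | P i) ip (F i) w.
Proof.
by elim/big_rec2 : _ => [|i x y _ <-]; rewrite ?ip0l ?ipDl.
Qed.

End semi_inner_product.

(** Evaluate at the minimizer t = - b / c; if c = 0, a nonnegative affine
   function of t is constant. *)
Lemma discriminant_nonpos (R : realType) (a b c : R) : 0 <= c ->
  (forall t, 0 <= a + 2 * t * b + t ^+ 2 * c) -> b ^+ 2 <= a * c.
Proof.
move=> c_ge0 q_ge0.
have [c_gt0|c_le0] := ltP 0 c.
  have := q_ge0 (- b / c).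
  have -> : a + 2 * (- b / c) * b + (- b / c) ^+ 2 * c = a - b ^+ 2 / c.
    by field; rewrite gt_eqF.
  by rewrite subr_ge0 ler_pdivrMr.
have c0 : c = 0 by apply/eqP; rewrite eq_le c_le0.
rewrite {}c0 mulr0 in q_ge0 *.
have [->|b_neq0] := eqVneq b 0; first by rewrite expr0n.
(* the affine function a + 2 t b takes the value -1 *)
have := q_ge0 (- (a + 1) / (2 * b)); rewrite mulr0 addr0.
have -> : a + 2 * (- (a + 1) / (2 * b)) * b = -1 by field.
lra.
Qed.

Lemma cvg_lower_bound (R : realType) (u : nat -> R) (a l : R) :
  u j @[j --> \oo] --> l -> (forall j, a <= u j) -> a <= l.
Proof.
move=> ul le_u; rewrite -(cvg_lim (@Rhausdorff R) ul).
by apply: limr_ge; [apply/cvg_ex; exists l | exact: nearW].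
Qed.

Lemma cvg_succ (R : realType) (u : nat -> R) (l : R) :
  u j @[j --> \oo] --> l -> u j.+1 @[j --> \oo] --> l.
Proof. by rewrite -(cvg_shiftS u). Qed.

(** * Symmetric operators, resolvents and the min-max principle *)

Section spectral.
Context (R : realType) (H : lmodType R) (ip : H -> H -> R).
Hypothesis ip_linear : forall a u v w, ip (a *: u + v) w = a * ip u w + ip v w.
Hypothesis ip_sym : forall u v, ip u v = ip v u.
Hypothesis ip_ge0 : forall u, 0 <= ip u u.
Let E := (ipE ip_linear ip_sym).

Lemma cauchy_schwarz u v : ip u v ^+ 2 <= ip u u * ip v v.
Proof.
apply: discriminant_nonpos => // t.
have -> : ip u u + 2 * t * ip u v + t ^+ 2 * ip v v = ip (u + t *: v) (u + t *: v).
  by rewrite !E (ip_sym v u); ring.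
exact: ip_ge0.
Qed.

Lemma ip_cvg0 (x : nat -> H) a : ip (x j) (x j) @[j --> \oo] --> (0 : R) ->
  ip a (x j) @[j --> \oo] --> (0 : R).
Proof.
move=> x0; apply/norm_cvg0P.
apply: (@squeeze_cvgr _ _ _ _ (fun=> 0)
  (fun j => Num.sqrt (ip a a) * Num.sqrt (ip (x j) (x j)))).
- apply: nearW => j; rewrite normr_ge0/=.
  rewrite -sqrtrM// -sqrtr_sqr ler_wsqrtr//; exact: cauchy_schwarz.
- exact: cvg_cst.
- rewrite -[X in _ --> X](mulr0 (Num.sqrt (ip a a))); apply: cvgMl_tmp.
  rewrite -[X in _ --> X](@sqrtr0 R).
  by apply: continuous_cvg => //; exact: sqrt_continuous.
Qed.

Lemma null_orth u v : ip u u = 0 -> ip u v = 0.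
Proof.
move=> u0; apply/eqP; rewrite -sqrf_eq0 eq_le sqr_ge0 andbT.
by rewrite (le_trans (cauchy_schwarz u v))// u0 mul0r.
Qed.

Lemma ip_sqD_le u v : ip (u + v) (u + v) <= 2 * ip u u + 2 * ip v v.
Proof. by have := ip_ge0 (u - v); rewrite !E (ip_sym v u); lra. Qed.

(* The operator A of the comments below is given by its graph, G u f meaning
   A u = f: the values of A are only determined up to null vectors of ip. *)
Variable G : H -> H -> Prop.
Hypothesis G_linear : forall a u f v g, G u f -> G v g ->
  G (a *: u + v) (a *: f + g).
Hypothesis G_sym : forall u f v g, G u f -> G v g -> ip f v = ip u g.
Hypothesis G_null : forall u f g, G u f -> ip (f - g) (f - g) = 0 -> G u g.

Definition resolvent (t : R) :=
  (forall f, exists u, G u (f + t *: u)) /\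
  (exists C, forall u f, G u f -> ip u u <= C * ip (f - t *: u) (f - t *: u)).

Lemma resolvent_gt0 t : resolvent t -> exists2 C, 0 < C &
  forall u f, G u f -> ip u u <= C * ip (f - t *: u) (f - t *: u).
Proof.
move=> [_ [C hC]]; exists (Num.max C 1); first by rewrite lt_max ltr01 orbT.
move=> u f Guf; apply: (le_trans (hC _ _ Guf)); apply: ler_wpM2r => //.
by rewrite le_max lexx.
Qed.

(** Put g = (A - mu) u and z = (A - mu)^-1 u. Then
   (A - mu - sqrt c) (A - mu + sqrt c) z = g - c z, whose squared norm is at
   most |g|^2 - c |u|^2. As both factors are bounded below, |u|^2 is bounded by
   a multiple of |g|^2 - c |u|^2, which improves the constant c. *)
Lemma resolvent_gap_step mu c : 0 < c -> resolvent mu ->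
  resolvent (mu + Num.sqrt c) -> resolvent (mu - Num.sqrt c) ->
  (forall u f, G u f -> c * ip u u <= ip (f - mu *: u) (f - mu *: u)) ->
  exists2 e, 0 < e & forall u f, G u f ->
    (c + e) * ip u u <= ip (f - mu *: u) (f - mu *: u).
Proof.
move=> c_gt0 [surj_mu _] /resolvent_gt0[C1 C1_gt0 hC1].
move=> /resolvent_gt0[C2 C2_gt0 hC2] hc.
set rho := Num.sqrt c in hC1 hC2.
have rho2 : rho ^+ 2 = c by rewrite sqr_sqrtr// ltW.
pose C3 := 2 * C1 + 2 * c * (C2 * C1).
have C3_gt0 : 0 < C3 by rewrite addr_gt0// !mulr_gt0.
exists C3^-1; first by rewrite invr_gt0.
move=> u f Guf; have [g gE] : {g | g = f - mu *: u} by exists (f - mu *: u).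
rewrite -gE.
have [z Gz] := surj_mu u.
have gz : ip g z = ip u u.
  by rewrite gE !E (G_sym Guf Gz) !E; ring.
have z_le : c * ip z z <= ip u u.
  by have := hc _ _ Gz; rewrite addrK.
have [r rE] : {r | r = g - c *: z} by exists (g - c *: z).
have r_le : ip r r <= ip g g - c * ip u u.
  rewrite rE !E (ip_sym z g) gz.
  have : c * (c * ip z z) <= c * ip u u by rewrite ler_pM2l.
  lra.
pose y := rho *: z + u.
have Gy : G y (rho *: (u + mu *: z) + f) by exact: G_linear.
have yr : ip (rho *: (u + mu *: z) + f - (mu + rho) *: y)
             (rho *: (u + mu *: z) + f - (mu + rho) *: y) = ip r r.
  rewrite /y rE gE -rho2 !E (ip_sym z u) (ip_sym f u) (ip_sym z f); ring.
have y_le : ip y y <= C1 * ip r r by rewrite -yr; exact: hC1.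
have z_le_y : ip z z <= C2 * ip y y.
  have := hC2 _ _ Gz; congr (_ <= _ * _).
  by rewrite /y !E (ip_sym z u); ring.
have u_le : ip u u <= 2 * ip y y + 2 * (c * ip z z).
  have -> : u = y + (- rho) *: z by rewrite /y addrC scaleNr addKr.
  apply: (le_trans (ip_sqD_le _ _)).
  by rewrite lerD2l [X in _ <= _ * X](_ : _ = ip (- rho *: z) (- rho *: z))// !E -rho2; ring.
have : ip u u <= C3 * ip r r.
  apply: (le_trans u_le); rewrite /C3 [in leRHS]mulrDl lerD//.
    by rewrite -mulrA ler_pM2l.
  rewrite -!mulrA !ler_pM2l//; apply: (le_trans z_le_y).
  by rewrite ler_pM2l.
move=> uC3; rewrite mulrDl -lerBrDl; apply: le_trans r_le.
by rewrite mulrC ler_pdivrMr// mulrC.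
Qed.

(** The best constant c such that c |u|^2 <= |(A - mu) u|^2 for all u cannot
   be smaller than h^2, since [resolvent_gap_step] would improve it. *)
Lemma resolvent_gap mu h : 0 <= h ->
  (forall t, mu - h < t < mu + h -> resolvent t) ->
  forall u f, G u f -> h ^+ 2 * ip u u <= ip (f - mu *: u) (f - mu *: u).
Proof.
move=> h_ge0 hres.
pose T := [set c : R | 0 <= c /\
  forall u f, G u f -> c * ip u u <= ip (f - mu *: u) (f - mu *: u)].
suff : T (h ^+ 2) by case.
have T0 : T 0 by split => // u f Guf; rewrite mul0r.
have [h0|h_neq0] := eqVneq h 0; first by rewrite h0 expr0n.
have h_gt0 : 0 < h by rewrite lt_neqAle eq_sym h_neq0.
have T_down c d : T c -> 0 <= d -> d <= c -> T d.
  move=> [_ Tc] d_ge0 dc; split => // u f Guf.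
  by apply: le_trans (Tc _ _ Guf); exact: ler_wpM2r.
apply: contrapT => Th.
have T_lt c : T c -> c < h ^+ 2.
  move=> Tc; rewrite ltNge; apply/negP => hc; apply: Th.
  by apply: T_down hc => //; exact: exprn_ge0.
have T_ub : has_ubound T by exists (h ^+ 2) => c /T_lt /ltW.
have T_sup : has_sup T by split => //; exists 0.
set c := sup T.
have c_ge0 : 0 <= c by apply: ub_le_sup.
have Tc : T c.
  split => // u f Guf.
  have [u0|u_neq0] := eqVneq (ip u u) 0; first by rewrite u0 mulr0.
  have u_gt0 : 0 < ip u u by rewrite lt_neqAle eq_sym u_neq0/=.
  rewrite -ler_pdivlMr//; apply: ge_sup; first by exists 0.
  by move=> d [_ Td]; rewrite ler_pdivlMr//; exact: Td.
have c_lt := T_lt _ Tc.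
have res_mu : resolvent mu by apply: hres; rewrite ltrDl h_gt0 gtrBl h_gt0.
have [c_gt0|c_le0] := ltP 0 c.
  have rho_lt : Num.sqrt c < h.
    by rewrite -(@ltr_pXn2r _ 2) ?nnegrE ?sqrtr_ge0// sqr_sqrtr.
  have rho_gt0 : 0 < Num.sqrt c by rewrite sqrtr_gt0.
  have [||e e_gt0 he] := resolvent_gap_step c_gt0 res_mu _ _ Tc.2.
  - by apply: hres; apply/andP; split; lra.
  - by apply: hres; apply/andP; split; lra.
  have : T (c + e) by split => //; rewrite addr_ge0// ltW.
  by move/(ub_le_sup T_ub); rewrite -/c; lra.
have [C C_gt0 hC] := resolvent_gt0 res_mu.
have : T C^-1.
  split; first by rewrite invr_ge0 ltW.
  by move=> u f Guf; rewrite mulrC ler_pdivrMr// mulrC hC.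
by move/(ub_le_sup T_ub); rewrite -/c leNgt (le_lt_trans c_le0)// invr_gt0.
Qed.
(** By [resolvent_gap] at mu = - T with h = l + T,
   |A u|^2 + 2 T <A u, u> >= (l^2 + 2 T l) |u|^2; let T be large. *)
Lemma bottom_of_spectrum l : (forall t, t < l -> resolvent t) ->
  forall u f, G u f -> l * ip u u <= ip f u.
Proof.
move=> hres u f Guf; rewrite leNgt; apply/negP => lt_l.
pose d := l * ip u u - ip f u.
have d_gt0 : 0 < d by rewrite subr_gt0.
(* large enough for 2 T d to exceed |f|^2 - l^2 |u|^2 *)
pose T := `|l| + 1 + (ip f f) / d.
have ff := ip_ge0 f.
have Td : T * d = (`|l| + 1) * d + ip f f by rewrite mulrDl divfK// gt_eqF.
have q_ge0 : 0 <= ip f f / d by rewrite divr_ge0// ltW.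
have lT : 0 <= l + T.
  by have := ler_norm (- l); rewrite normrN /T => ?; lra.
have hT : forall t, - T - (l + T) < t < - T + (l + T) -> resolvent t.
  by move=> t /andP[_ tl]; apply: hres; lra.
have uu := ip_ge0 u; have ll := normr_ge0 l; have l1 := ler_norm (- l).
rewrite normrN in l1.
have := resolvent_gap lT hT Guf; apply/negP; rewrite -ltNge -subr_gt0.
have -> : (l + T) ^+ 2 * ip u u - ip (f - - T *: u) (f - - T *: u) =
    l ^+ 2 * ip u u + 2 * (T * d) - ip f f.
  by rewrite /d !E (ip_sym u f); ring.
rewrite Td.
have : 0 <= l ^+ 2 * ip u u by rewrite mulr_ge0// sqr_ge0.
have : 0 <= `|l| * d by rewrite mulr_ge0// ltW.
lra.
Qed.

Hypothesis complete : forall (x : nat -> H) C theta, 0 <= theta < 1 ->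
  (forall j, ip (x j - x j.+1) (x j - x j.+1) <= C * theta ^+ j) ->
  exists w, ip (x j - w) (x j - w) @[j --> \oo] --> (0 : R).

Section next_eigenvalue.
Variables (K : H -> Prop) (s s' : R).
Hypothesis K_linear : forall a u v, K u -> K v -> K (a *: u + v).
Hypothesis K_inv : forall u f, G u f -> K f -> K u.
Hypothesis s_gt0 : 0 < s.
Hypothesis s_lt : s < s'.
Hypothesis res0 : resolvent 0.
Hypothesis gap : forall t, s < t < s' -> resolvent t.
Hypothesis K_ge : forall u f, G u f -> K u -> s * ip u u <= ip f u.

(** A form of <(A - s) v, (A - s') v> >= 0, which is [resolvent_gap] at the
   middle of the interval (s, s'). *)
Lemma range_gap v g : G v g ->
  (s' - s) * ip (g - s *: v) v <= ip (g - s *: v) (g - s *: v).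
Proof.
move=> Gvg.
have h_ge0 : 0 <= (s' - s) / 2 by rewrite divr_ge0 ?subr_ge0 ?ltW.
have hgap t : (s + s') / 2 - (s' - s) / 2 < t < (s + s') / 2 + (s' - s) / 2 ->
    resolvent t.
  by move=> /andP[t1 t2]; apply: gap; apply/andP; split; lra.
have := resolvent_gap h_ge0 hgap Gvg.
rewrite !E (ip_sym v g) -subr_ge0 => gap_ge0; rewrite -subr_ge0.
by apply: le_trans gap_ge0 _; rewrite le_eqVlt; apply/orP; left; apply/eqP; field.
Qed.

(** For u = (A - s) v, Cauchy-Schwarz for the nonnegative form
   <(A - s) _, _> on K bounds |u|^4 = <(A - s) v, u>^2 by
   <(A - s) v, v> <(A - s) u, u>, where the first factor is at most
   |u|^2 / (s' - s) by [range_gap]. *)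
Lemma range_ge v g u f : G v g -> K v -> G u f -> K u -> u = g - s *: v ->
  s' * ip u u <= ip f u.
Proof.
move=> Gvg Kv Guf Ku uE.
have uv_ge : (s' - s) * ip u v <= ip u u by rewrite uE; exact: range_gap.
have fsu_ge0 : 0 <= ip f u - s * ip u u by rewrite subr_ge0 K_ge.
have fv : ip f v = ip u g by exact: G_sym.
have gE : g = u + s *: v by rewrite uE subrK.
have cs : (ip u u) ^+ 2 <= ip u v * (ip f u - s * ip u u).
  apply: discriminant_nonpos => // t.
  have := K_ge (G_linear t Guf Gvg) (K_linear t Ku Kv).
  rewrite gE !E fv gE !E (ip_sym v u) -subr_ge0 => /le_trans; apply.
  by rewrite le_eqVlt; apply/orP; left; apply/eqP; ring.
have [u0|u_neq0] := eqVneq (ip u u) 0.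
  by rewrite u0 mulr0; move: fsu_ge0; rewrite u0 mulr0 subr0.
have u_gt0 : 0 < ip u u by rewrite lt_neqAle eq_sym u_neq0/=.
have : (s' - s) * (ip u u * ip u u) <= ip u u * (ip f u - s * ip u u).
  rewrite -expr2; apply: (@le_trans _ _ ((s' - s) * (ip u v * (ip f u - s * ip u u)))).
    by rewrite ler_pM2l// subr_gt0.
  by rewrite mulrA ler_wpM2r.
by rewrite mulrCA ler_pM2l//; lra.
Qed.

(** Here x_j = N^j x_0 with N = s A^-1. The differences x_j - x_(j+1) belong
   to the range of A - s, on which N contracts by s / s' in view of
   [range_ge]. So x_j converges, to a fixed vector of N; this limit is both an
   eigenvector for s and orthogonal to all of them. *)
Lemma iterates_cvg0 (x : nat -> H) : (forall j, G (x j.+1) (s *: x j)) ->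
  K (x 0%N) ->
  (forall v, G v (s *: v) -> ip (x 0%N) v = 0) ->
  ip (x j) (x j) @[j --> \oo] --> (0 : R).
Proof.
move=> Gx K0 orth0.
have s_neq0 : s != 0 by rewrite gt_eqF.
have Kz u a : K u -> K (a *: u).
  move=> Ku; have := K_linear (a - 1) Ku Ku.
  by rewrite -{2}(scale1r u) -scalerDl subrK.
have Kx j : K (x j) by elim: j => // j IHj; apply: (K_inv (Gx j)); exact: Kz.
have G0 : G 0 0.
  have := G_linear (-1) (Gx 0%N) (Gx 0%N).
  by rewrite !scaleN1r !addNr.
pose d j := x j - x j.+1.
have dE j : x j - x j.+1 = d j by [].
have Kd j : K (d j) by rewrite /d addrC -scaleN1r; exact: K_linear.
have Gd j : G (d j.+1) (s *: d j).
  have := G_linear (-1) (Gx j.+1) (Gx j).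
  by rewrite !scaleN1r -scalerN -scalerDr (addrC (- _)) (addrC (- x j.+1)).
have d_ge j : s' * ip (d j.+1) (d j.+1) <= s * ip (d j) (d j.+1).
  rewrite -[in leRHS](ipZl ip_linear).
  have Gxj := G_linear s^-1 (Gx j.+1) G0; rewrite !addr0 in Gxj.
  apply: (range_ge Gxj _ (Gd j) (Kd _)); first exact: Kz.
  by rewrite !scalerA mulVf// mulfV// !scale1r.
have s'_gt0 : 0 < s' by exact: lt_trans s_lt.
pose theta := (s / s') ^+ 2.
have theta_itv : 0 <= theta < 1.
  rewrite sqr_ge0/= expr_lt1// ?divr_ge0 ?ltW//.
  by rewrite ltr_pdivrMr// mul1r.
have d_step j : ip (d j.+1) (d j.+1) <= theta * ip (d j) (d j).
  rewrite /theta expr_div_n mulrAC ler_pdivlMr ?exprn_gt0//.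
  have [->|d_neq0] := eqVneq (ip (d j.+1) (d j.+1)) 0.
    by rewrite mul0r mulr_ge0// sqr_ge0.
  have d_gt0 : 0 < ip (d j.+1) (d j.+1) by rewrite lt_neqAle eq_sym d_neq0/=.
  rewrite -(ler_pM2l d_gt0).
  apply: (@le_trans _ _ ((s * ip (d j) (d j.+1)) ^+ 2)).
    rewrite mulrA -expr2 -exprMn (mulrC _ s').
    have d'_ge0 : 0 <= s' * ip (d j.+1) (d j.+1) by rewrite mulr_ge0// ltW.
    by rewrite lerXn2r// nnegrE// (le_trans d'_ge0).
  rewrite exprMn [in leRHS]mulrCA ler_pM2l ?exprn_gt0// [in leRHS]mulrC; exact: cauchy_schwarz.
have d_le j : ip (d j) (d j) <= ip (d 0%N) (d 0%N) * theta ^+ j.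
  elim: j => [|j IHj]; first by rewrite expr0 mulr1.
  apply: (le_trans (d_step j)); rewrite exprS mulrCA ler_wpM2l//.
  by case/andP : theta_itv.
have [w xw] := complete theta_itv d_le.
have [y Gy] := res0.1 (s *: w); rewrite scale0r addr0 in Gy.
have [C C_gt0 hC] := resolvent_gt0 res0.
have yw0 : ip (y - w) (y - w) = 0.
  apply/eqP; rewrite eq_le ip_ge0 andbT.
  apply: (@cvg_lower_bound _ (fun j =>
    2 * (C * (s ^+ 2 * ip (x j - w) (x j - w))) +
    2 * ip (x j.+1 - w) (x j.+1 - w))).
    rewrite [X in _ --> X](_ : _ = 2 * (C * (s ^+ 2 * 0)) + 2 * (0 : R)); last first.
      by rewrite !mulr0 addr0.
    apply: cvgD; last by apply: cvgMl_tmp; exact: (@cvg_succ _ (fun j => ip (x j - w) (x j - w))).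
    by do 3 apply: cvgMl_tmp.
  move=> j /=.
  have -> : y - w = (- 1) *: (x j.+1 - y) + (x j.+1 - w).
    by rewrite scaleN1r opprB addrA subrK.
  apply: (le_trans (ip_sqD_le _ _)); rewrite lerD2r ler_pM2l//.
  have := hC _ _ (G_linear (-1) Gy (Gx j)); rewrite scale0r subr0.
  by congr (_ <= _); rewrite !E;
    [rewrite (ip_sym y (x j.+1))|rewrite (ip_sym w (x j))]; ring.
have Gyy : G y (s *: y).
  by apply: G_null Gy _; rewrite -scalerBr -opprB !E; move: yw0; rewrite !E; nra.
have xy0 j : ip (x j) y = 0.
  elim: j => [|j IHj]; first exact: orth0.
  have := G_sym (Gx j) Gyy; rewrite !E IHj mulr0 => /esym/eqP.
  by rewrite mulf_eq0 (negbTE s_neq0) => /eqP.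
have ynull : ip y y = 0.
  apply/eqP; rewrite eq_le ip_ge0 andbT.
  have yxw j : ip y y <= - ip y (x j - w).
    have -> : ip y y = ip (y - w) y - ip (x j - w) y.
      by rewrite !E xy0; ring.
    by rewrite (null_orth _ yw0) sub0r ip_sym.
  apply: (cvg_lower_bound _ yxw); rewrite -[X in _ --> X]oppr0.
  by apply: cvgN; apply: ip_cvg0.
have wnull : ip w w = 0.
  have -> : w = y - (y - w) by rewrite opprB addrC subrK.
  by rewrite !E; move: (null_orth w yw0) (null_orth y yw0); rewrite !E;
     rewrite (ip_sym w y) ynull; lra.
rewrite [X in X @ _](_ : _ = fun j => ip (x j - w) (x j - w)).
  exact: xw.
apply/funext => j; rewrite !E (ip_sym (x j) w) (null_orth (x j) wnull) wnull.
by rewrite !oppr0 !addr0.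
Qed.

(** With N = s A^-1, the vector u - N^j u belongs to the range of A - s, where
   [range_ge] applies, and N^j u tends to 0. *)
Lemma next_eigenvalue u f : G u f -> K u ->
  (forall v, G v (s *: v) -> ip u v = 0) -> s' * ip u u <= ip f u.
Proof.
move=> Guf Ku u_orth.
have s_neq0 : s != 0 by rewrite gt_eqF.
have Kz v a : K v -> K (a *: v).
  move=> Kv; have := K_linear (a - 1) Kv Kv.
  by rewrite -{2}(scale1r v) -scalerDl subrK.
have [N GN] := choice res0.1.
have GN' v : G (N v) v by have := GN v; rewrite scale0r addr0.
pose x j := iter j (fun v => N (s *: v)) u.
have Gx j : G (x j.+1) (s *: x j) by exact: GN'.
have Kx j : K (x j) by elim: j => // j IHj; apply: (K_inv (Gx j)); exact: Kz.
have x0 : ip (x j) (x j) @[j --> \oo] --> (0 : R) by apply: iterates_cvg0.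
have x0S : ip (x j.+1) (x j.+1) @[j --> \oo] --> (0 : R).
  exact: (@cvg_succ _ (fun j => ip (x j) (x j)) _ x0).
have range j : exists v g, [/\ G v g, K v & u - x j = g - s *: v].
  elim: j => [|j [v [g [Gvg Kv uE]]]].
    exists (0 *: u), (0 *: f); split; last by rewrite !scale0r scaler0 !subrr.
      by have := G_linear (-1) Guf Guf; rewrite !scale0r !scaleN1r !addNr.
    exact: Kz.
  exists (s^-1 *: x j.+1 + v), (s^-1 *: (s *: x j) + g); split.
  - exact: G_linear.
  - exact: K_linear.
  - rewrite scalerDr !scalerA mulVf// mulfV// !scale1r.
    by rewrite opprD addrACA -uE addrC addrA subrK.
have le_j j : s' * ip (u - x j.+1) (u - x j.+1) <= ip (f - s *: x j) (u - x j.+1).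
  have [v [g [Gvg Kv uE]]] := range j.+1.
  apply: (range_ge Gvg Kv _ _ uE).
    have := G_linear (-1) (Gx j) Guf.
    by rewrite !scaleN1r !(addrC (- _)).
  by rewrite addrC -scaleN1r; exact: K_linear.
rewrite -subr_ge0.
pose e j := (ip (f - s *: x j) (u - x j.+1) - s' * ip (u - x j.+1) (u - x j.+1)).
apply: (@cvg_lower_bound _ e); last by move=> j; rewrite subr_ge0.
have eE j : e j = ip f u - s' * ip u u - s * ip u (x j) - ip f (x j.+1) +
    s * (ip (x j) (x j.+1)) + 2 * s' * ip u (x j.+1) - s' * ip (x j.+1) (x j.+1).
  by rewrite /e !E (ip_sym (x j) u) (ip_sym (x j.+1) u); ring.
have xx0 : ip (x j) (x j.+1) @[j --> \oo] --> (0 : R).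
  apply/norm_cvg0P.
  apply: (@squeeze_cvgr _ _ _ _ (fun=> 0)
    (fun j => ip (x j) (x j) + ip (x j.+1) (x j.+1))).
  - apply: nearW => j; rewrite normr_ge0/= ler_norml.
    have := ip_ge0 (x j - x j.+1); have := ip_ge0 (x j + x j.+1).
    rewrite !E (ip_sym (x j.+1) (x j)).
    have := ip_ge0 (x j); have := ip_ge0 (x j.+1) => *; apply/andP; split; lra.
  - exact: cvg_cst.
  - by rewrite -[X in _ --> X](addr0 (0 : R)); apply: cvgD.
rewrite (funext eE).
rewrite [X in _ --> X](_ : _ = ip f u - s' * ip u u - s * 0 - 0 + s * 0 +
  2 * s' * 0 - s' * 0); last by ring.
apply: cvgB; last exact: cvgMl_tmp.
apply: cvgD; last by apply: cvgMl_tmp; exact: (@ip_cvg0 (fun j => x j.+1)).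
apply: cvgD; last exact: cvgMl_tmp.
apply: cvgB; last exact: (@ip_cvg0 (fun j => x j.+1)).
apply: cvgB; last by apply: cvgMl_tmp; exact: ip_cvg0.
exact: cvg_cst.
Qed.
End next_eigenvalue.

Definition eigenvector mu v := G v (mu *: v).

(** By induction on k: the interval between two distinct consecutive
   eigenvalues is a gap in the spectrum, which [next_eigenvalue] crosses. *)
Lemma rayleigh_lower_bound (lam : nat -> R) : 0 < lam 0%N ->
  {homo lam : i j / (i <= j)%N >-> i <= j} ->
  (forall t, (forall k, lam k != t) -> resolvent t) ->
  forall k u f, G u f ->
    (forall mu v, 0 < mu < lam k -> eigenvector mu v -> ip u v = 0) ->
    lam k * ip u u <= ip f u.
Proof.
move=> lam0 lam_homo lam_res.
have lam_gt0 k : 0 < lam k by apply: lt_le_trans lam0 _; exact: lam_homo.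
have res_lt t : t < lam 0%N -> resolvent t.
  move=> t_lt; apply: lam_res => k; rewrite gt_eqF//.
  by apply: lt_le_trans t_lt _; exact: lam_homo.
elim=> [u f Guf _|k IHk u f Guf u_orth].
  exact: bottom_of_spectrum.
have [lamE|lam_neq] := eqVneq (lam k) (lam k.+1).
  by rewrite -lamE; apply: IHk => // mu v mu_lt; apply: u_orth; rewrite -lamE.
have lam_lt : lam k < lam k.+1 by rewrite lt_neqAle lam_neq lam_homo.
pose K u := forall mu v, 0 < mu < lam k -> eigenvector mu v -> ip u v = 0.
have Ku : K u.
  by move=> mu v /andP[mu0 mu_lt]; apply: u_orth; rewrite mu0 (lt_trans mu_lt).
apply: (@next_eigenvalue K (lam k)) => //.
- by move=> a v w Kv Kw mu z mu_itv Gz; rewrite !E (Kv _ _ mu_itv Gz) (Kw _ _ mu_itv Gz) mulr0 addr0.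
- move=> v g Gvg Kg mu w mu_itv Gw.
  have := G_sym Gvg Gw; rewrite (Kg _ _ mu_itv Gw) !E => /esym/eqP.
  rewrite mulf_eq0 => /orP[/eqP mu0|/eqP//].
  by move: mu_itv; rewrite mu0 ltxx.
- exact: res_lt.
- move=> t /andP[t1 t2]; apply: lam_res => j.
  have [jk|kj] := leqP j k.
    by rewrite lt_eqF// (le_lt_trans _ t1)// lam_homo.
  by rewrite gt_eqF// (lt_le_trans t2)// lam_homo.
- by move=> v Gv; apply: u_orth Gv; rewrite lam_gt0.
Qed.

Lemma graph_sum (I : Type) (r : seq I) (c : I -> R) (e Ae : I -> H) : G 0 0 ->
  (forall i, G (e i) (Ae i)) ->
  G (\sum_(i <- r) c i *: e i) (\sum_(i <- r) c i *: Ae i).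
Proof.
move=> G0 Ge; elim: r => [|i r IHr]; first by rewrite !big_nil.
by rewrite !big_cons; exact: G_linear.
Qed.

Lemma ip_sum_diag k (c : 'I_k -> R) (a b : 'I_k -> H) :
  (forall i j, i != j -> ip (a i) (b j) = 0) ->
  ip (\sum_i c i *: a i) (\sum_i c i *: b i) = \sum_i c i ^+ 2 * ip (a i) (b i).
Proof.
move=> ab0; rewrite (ip_suml ip_linear); apply: eq_bigr => i _.
rewrite ip_sym (ip_suml ip_linear) (bigD1 i)//= big1 ?addr0; last first.
  by move=> j ji; rewrite !E (ip_sym (b j)) ab0 ?mulr0// eq_sym.
by rewrite !E (ip_sym (b i)); ring.
Qed.

(** Some nonzero combination of the k + 1 vectors e_i is orthogonal to the k
   vectors v_j, hence to the eigenspaces below lam k: its Rayleigh quotient is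
   at least lam k by [rayleigh_lower_bound], and at most M. *)
Lemma minmax_upper (lam : nat -> R) (M : R) k (e Ae : 'I_k.+1 -> H) (v : nat -> H) :
  0 < lam 0%N -> {homo lam : i j / (i <= j)%N >-> i <= j} ->
  (forall t, (forall k, lam k != t) -> resolvent t) ->
  (forall u mu w, 0 < mu < lam k -> eigenvector mu w ->
    (forall j, (j < k)%N -> ip u (v j) = 0) -> ip u w = 0) ->
  (forall i, G (e i) (Ae i)) ->
  (forall i j, i != j -> ip (e i) (e j) = 0) ->
  (forall i j, i != j -> ip (Ae i) (e j) = 0) ->
  (forall i, 0 < ip (e i) (e i)) ->
  (forall i, ip (Ae i) (e i) <= M * ip (e i) (e i)) ->
  lam k <= M.
Proof.
move=> lam0 lam_homo lam_res eig_span Ge e_orth Ae_orth e_gt0 Ae_le.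
pose A : 'M[R]_(k.+1, k) := \matrix_(i, j) ip (e i) (v j).
have [c cA c_neq0] : exists2 c : 'rV[R]_k.+1, c *m A = 0 & c != 0.
  have : kermx A != 0.
    by rewrite -mxrank_eq0 mxrank_ker -lt0n subn_gt0 ltnS rank_leq_col.
  by move/rowV0Pn => [c /sub_kermxP cA c0]; exists c.
pose u := \sum_i c ord0 i *: e i.
pose f := \sum_i c ord0 i *: Ae i.
have G0 : G 0 0.
  by have := G_linear (-1) (Ge ord0) (Ge ord0); rewrite !scaleN1r !addNr.
have Guf : G u f by exact: graph_sum.
have u_orth j : (j < k)%N -> ip u (v j) = 0.
  move=> jk; have /rowP/(_ (Ordinal jk)) := cA; rewrite !mxE => <-.
  by rewrite (ip_suml ip_linear); apply: eq_bigr => i _; rewrite !E mxE.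
have lam_le : lam k * ip u u <= ip f u.
  apply: rayleigh_lower_bound => // mu w mu_itv Gw.
  exact: eig_span mu_itv Gw u_orth.
have fu_le : ip f u <= M * ip u u.
  rewrite !ip_sum_diag// mulr_sumr; apply: ler_sum => i _.
  by rewrite mulrCA ler_wpM2l ?sqr_ge0.
have u_gt0 : 0 < ip u u.
  rewrite ip_sum_diag//.
  have [i ci] : exists i, c ord0 i != 0.
    apply/existsP; apply: contraNT c_neq0; rewrite negb_exists => /forallP ci.
    by apply/eqP/rowP => i; rewrite mxE; apply/eqP; have := ci i; rewrite negbK.
  rewrite (bigD1 i)//= ltr_pwDl//.
    by rewrite mulr_gt0// lt_neqAle sqr_ge0 eq_sym sqrf_eq0 ci.
  by apply: sumr_ge0 => j _; rewrite mulr_ge0 ?sqr_ge0.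
by rewrite -(ler_pM2r u_gt0) (le_trans lam_le).
Qed.
End spectral.

(** * The space L^2 *)

Section L2_space.
Context {R : realType} {n : nat}.
Local Notation E := 'rV[R]_n.
Local Notation leb := (lebesgue_rV R n).
Variable D : set E.
Hypothesis mD : measurable D.
Implicit Types u v w : E -> R.

Definition dotp (D : set E) u v : R := \int[leb]_(x in D) (u x * v x).

Lemma L2_mul_integrable u v : L2 D u -> L2 D v ->
  leb.-integrable D (EFin \o (fun x => u x * v x)).
Proof.
move=> [mu fu] [mv fv].
have isq w : measurable_fun D w -> (sqnorm D w < +oo)%E ->
    leb.-integrable D (EFin \o (fun x => w x ^+ 2)).
  move=> mw fw; apply/integrableP; split.
    by apply/measurable_EFinP; exact: measurable_funX.
  rewrite (eq_integral (fun x => (w x ^+ 2)%:E))// => x _ /=.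
  by rewrite ger0_norm// sqr_ge0.
apply: (@le_integrable _ _ _ _ _ mD _
  ((EFin \o (fun x => u x ^+ 2)%R) \+ (EFin \o (fun x => v x ^+ 2)%R))%E).
- by apply/measurable_EFinP; exact: measurable_funM.
- move=> x _ /=; rewrite lee_fin [leRHS]ger0_norm ?addr_ge0 ?sqr_ge0//.
  rewrite ler_norml; have := sqr_ge0 (u x + v x); have := sqr_ge0 (u x - v x).
  have := sqr_ge0 (u x); have := sqr_ge0 (v x).
  by rewrite !expr2 => *; apply/andP; split; nra.
- by apply: integrableD => //; exact: isq.
Qed.

Lemma dotp_linear a u v w : L2 D u -> L2 D v -> L2 D w ->
  dotp D (fun x => a * u x + v x) w = a * dotp D u w + dotp D v w.
Proof.
move=> Lu Lv Lw; rewrite /dotp.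
have iu := L2_mul_integrable Lu Lw.
rewrite -RintegralZl// -RintegralD//; last exact: L2_mul_integrable.
  by apply: eq_Rintegral => x _; rewrite mulrDl mulrA.
have := integrableZl mD a iu; apply: eq_integrable => // x _ /=.
Qed.

Lemma dotpC u v : dotp D u v = dotp D v u.
Proof. by apply: eq_Rintegral => x _; rewrite mulrC. Qed.

Lemma dotp_ge0 u : 0 <= dotp D u u.
Proof. by apply: Rintegral_ge0 => x _; rewrite -expr2 sqr_ge0. Qed.

Lemma sqnormE u : L2 D u -> sqnorm D u = (dotp D u u)%:E.
Proof.
move=> Lu; rewrite /sqnorm /dotp /Rintegral fineK//.
exact: integrable_fin_num (L2_mul_integrable Lu Lu).
Qed.

Lemma sqnormD_le a u v : L2 D u -> L2 D v ->
  (sqnorm D (fun x => a * u x + v x)%R <=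
   (2 * a ^+ 2)%:E * sqnorm D u + 2%:E * sqnorm D v)%E.
Proof.
move=> [mu fu] [mv fv].
have m2 w : measurable_fun D w -> measurable_fun D (fun x => (w x ^+ 2)%:E).
  by move=> mw; apply/measurable_EFinP; exact: measurable_funX.
have zl k w : 0 <= k -> measurable_fun D w ->
    (k%:E * sqnorm D w = \int[leb]_(x in D) (k%:E * (w x ^+ 2)%:E))%E.
  move=> k0 mw; rewrite ge0_integralZl_EFin//; last exact: m2.
  by move=> x _; rewrite lee_fin sqr_ge0.
rewrite !zl//; last by rewrite mulr_ge0// sqr_ge0.
rewrite -ge0_integralD//; last 4 first.
- by move=> x _; rewrite mule_ge0// lee_fin ?sqr_ge0// mulr_ge0 ?sqr_ge0.
- by apply: measurable_funeM; exact: m2.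
- by move=> x _; rewrite mule_ge0// lee_fin ?sqr_ge0// mulr_ge0 ?sqr_ge0.
- by apply: measurable_funeM; exact: m2.
apply: ge0_le_integral => //.
- by move=> x _; rewrite lee_fin sqr_ge0.
- apply: m2; apply: measurable_funD => //.
  by apply: measurable_funM => //; exact: measurable_cst.
- by apply: emeasurable_funD; apply: measurable_funeM; exact: m2.
- move=> x _; rewrite -!EFinM -EFinD lee_fin -subr_ge0.
  by rewrite (_ : _ - _ = (a * u x - v x) ^+ 2) ?sqr_ge0//; ring.
Qed.

Lemma L2_linear a u v : L2 D u -> L2 D v -> L2 D (fun x => a * u x + v x).
Proof.
move=> Lu Lv; split.
  by apply: measurable_funD; [apply: measurable_funM|]; case: Lu Lv => // + _ [].
apply: (le_lt_trans (sqnormD_le a Lu Lv)).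
by rewrite !sqnormE// -!EFinM -EFinD ltry.
Qed.

Lemma L2_cst0 : L2 D (fun=> 0).
Proof.
split; first exact: measurable_cst.
rewrite /sqnorm (eq_integral (cst 0%E)) ?integral0// => x _.
by rewrite expr0n.
Qed.

Lemma dotp_eq0_ae u : L2 D u -> dotp D u u = 0 ->
  {ae leb, forall x, D x -> u x = 0}.
Proof.
move=> Lu u0.
have : (\int[leb]_(x in D) `|(u x ^+ 2)%:E| = 0)%E.
  rewrite (eq_integral (fun x => (u x ^+ 2)%:E)); last first.
    by move=> x _ /=; rewrite ger0_norm// sqr_ge0.
  by rewrite -/(sqnorm D u) sqnormE// u0.
move/(ae_eq_integral_abs leb mD) => H; apply: filterS (H _) => [x /= h Dx|].
  by have /eqP := h Dx; rewrite eqe sqrf_eq0 => /eqP.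
by apply/measurable_EFinP; apply: measurable_funX; case: Lu.
Qed.

Lemma dotp_ae u v w : L2 D u -> L2 D v -> L2 D w ->
  {ae leb, forall x, D x -> u x = v x} -> dotp D u w = dotp D v w.
Proof.
move=> [mu _] [mv _] [mw _] uv; rewrite /dotp /Rintegral; congr fine.
apply: ae_eq_integral => //.
- by apply/measurable_EFinP; exact: measurable_funM.
- by apply/measurable_EFinP; exact: measurable_funM.
- by apply: filterS uv => x /= h Dx; rewrite h.
Qed.

End L2_space.

(** * Completeness of L^2 *)

Lemma geometric_cauchy (R : realType) (a : nat -> R) K rho : 0 <= rho < 1 ->
  (forall j, `|a j - a j.+1| <= K * rho ^+ j) ->
  exists2 l, a j @[j --> \oo] --> l &
    forall j, `|a j - l| <= K * rho ^+ j / (1 - rho).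
Proof.
move=> /andP[rho0 rho1] ha.
have K0 : 0 <= K by have := ha 0%N; rewrite expr0 mulr1; exact: le_trans.
have rho1' : 0 < 1 - rho by rewrite subr_gt0.
have tail j i : `|a j - a (j + i)%N| <= K * rho ^+ j * (1 - rho ^+ i) / (1 - rho).
  elim: i => [|i IHi]; first by rewrite addn0 expr0 !subrr normr0 mulr0 mul0r.
  rewrite (_ : a j - _ = (a j - a (j + i)%N) + (a (j + i)%N - a (j + i.+1)%N)); last first.
    by rewrite addrA subrK.
  apply: (le_trans (ler_normD _ _)); apply: (le_trans (lerD IHi _)).
    by rewrite addnS; exact: ha.
  rewrite le_eqVlt; apply/orP; left; apply/eqP.
  by rewrite exprD exprS; field; rewrite gt_eqF.
have tail' j i : `|a j - a (j + i)%N| <= K * rho ^+ j / (1 - rho).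
  apply: (le_trans (tail j i)); rewrite ler_pM2r ?invr_gt0//.
  by rewrite ler_piMr ?mulr_ge0 ?exprn_ge0// gerBl exprn_ge0.
have da : cvgn (series (fun j => a j.+1 - a j)).
  apply: normed_cvg; apply: (@series_le_cvg _ _ (geometric K rho)).
  - by move=> j; exact: normr_ge0.
  - by move=> j; rewrite /geometric/= mulr_ge0// exprn_ge0.
  - by move=> j /=; rewrite distrC; exact: ha.
  - by apply: is_cvg_geometric_series; rewrite ger0_norm.
have aE : a = (fun j => a 0%N + series (fun j => a j.+1 - a j) j).
  by apply/funext => j; rewrite seriesEnat/= telescope_sumr// addrC subrK.
have ca : cvgn a by rewrite aE; apply: is_cvgD => //; exact: is_cvg_cst.
exists (limn a) => // j.
have h : `|a j - a (j + i)%N| @[i --> \oo] --> `|a j - limn a|.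
  apply: cvg_norm; apply: cvgB; first exact: cvg_cst.
  rewrite (_ : (fun i => a (j + i)%N) = (fun i => a (i + j)%N)); last first.
    by apply/funext => i; rewrite addnC.
  by rewrite (cvg_shiftn j a).
rewrite -(cvg_lim (@Rhausdorff R) h).
by apply: limr_le; [apply/cvg_ex; exists `|a j - limn a| | exact: nearW].
Qed.

Section L2_complete.
Context {R : realType} {n : nat}.
Local Notation E := 'rV[R]_n.
Local Notation leb := (lebesgue_rV R n).
Variable D : set E.
Hypothesis mD : measurable D.

(** Let d_j = x_j - x_(j+1) and theta < rho^2 < 1. The function
   F = \sum_j rho^(-2j) d_j^2 has a finite integral and |d_j| <= rho^j sqrt F,
   so x_j converges wherever F is finite, and (x_j - w)^2 <= c rho^(2j) F,
   which is trivial where F = +oo. *)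
Lemma L2_complete (x : nat -> E -> R) (C theta : R) : 0 <= theta < 1 ->
  (forall j, L2 D (x j)) ->
  (forall j, dotp D (fun y => x j y - x j.+1 y) (fun y => x j y - x j.+1 y) <=
             C * theta ^+ j) ->
  exists2 w, L2 D w &
    dotp D (fun y => x j y - w y) (fun y => x j y - w y) @[j --> \oo] --> (0 : R).
Proof.
move=> /andP[theta0 theta1] Lx hx.
pose d j y := x j y - x j.+1 y.
have L2B u v : L2 D u -> L2 D v -> L2 D (fun y => u y - v y).
  move=> Lu Lv; have := L2_linear mD (-1) Lv Lu.
  by congr (L2 D _); apply/funext => y; rewrite mulN1r addrC.
have Ld j : L2 D (d j) by exact: L2B.
have C0 : 0 <= C.
  by have := hx 0%N; rewrite expr0 mulr1; apply: le_trans; exact: dotp_ge0.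
pose rho := Num.sqrt ((theta + 1) / 2).
have rho_sq : rho ^+ 2 = (theta + 1) / 2 by rewrite sqr_sqrtr// divr_ge0// addr_ge0.
have rho_gt0 : 0 < rho by rewrite sqrtr_gt0 divr_gt0// ltr_wpDl.
have rho_lt1 : rho < 1.
  by rewrite -(@ltr_pXn2r _ 2) ?nnegrE ?ltW// rho_sq expr1n ltr_pdivrMr//; lra.
pose q := theta / rho ^+ 2.
have rho2_gt0 : 0 < rho ^+ 2 by rewrite exprn_gt0.
have q_ge0 : 0 <= q by rewrite divr_ge0// ltW.
have q_lt1 : q < 1 by rewrite ltr_pdivrMr// rho_sq mul1r ltr_pdivlMr//; lra.
pose t j y := ((rho ^+ 2) ^- j * d j y ^+ 2)%:E.
have t_ge0 j y : (0 <= t j y)%E.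
  by rewrite lee_fin mulr_ge0 ?sqr_ge0// invr_ge0 exprn_ge0// ltW.
have mt j : measurable_fun D (t j).
  apply/measurable_EFinP; apply: measurable_funM => //.
  by apply: measurable_funX; case: (Ld j).
pose F y := (\sum_(0 <= j <oo) t j y)%E.
have mF : measurable_fun D F.
  by apply: ge0_emeasurable_sum => // j y _ _.
have intt j : (\int[leb]_(y in D) t j y <= (C * q ^+ j)%:E)%E.
  rewrite (eq_integral (fun y => ((rho ^+ 2) ^- j)%:E * (d j y ^+ 2)%:E)%E)//.
  rewrite ge0_integralZl_EFin//; last 3 first.
  - by move=> y _; rewrite lee_fin sqr_ge0.
  - by apply/measurable_EFinP; apply: measurable_funX; case: (Ld j).
  - by rewrite invr_ge0 exprn_ge0// ltW.
  rewrite -/(sqnorm D (d j)) sqnormE// -EFinM lee_fin.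
  rewrite /q expr_div_n mulrA [leRHS]mulrC ler_pM2l ?hx//.
  by rewrite invr_gt0 exprn_gt0.
have intF : (\int[leb]_(y in D) F y <= (C / (1 - q))%:E)%E.
  rewrite integral_nneseries//.
  apply: lime_le.
    by apply: is_cvg_nneseries => j _ _; exact: integral_ge0.
  apply: nearW => N; apply: (@le_trans _ _ (\sum_(0 <= j < N) (C * q ^+ j)%:E)%E).
    by apply: lee_sum => j _; exact: intt.
  rewrite sumEFin lee_fin.
  have := @geometric_seriesE R C q; rewrite lt_eqF// => /(_ isT)/(congr1 (fun f => f N)).
  rewrite seriesEnat/= => ->; rewrite ler_pM2r ?invr_gt0 ?subr_gt0//.
  by rewrite ler_piMr// gerBl exprn_ge0.
have t_leF j y : (t j y <= F y)%E.
  apply: (@le_trans _ _ (\sum_(0 <= i < j.+1) t i y)%E).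
    by rewrite big_nat_recr//= leeDr// sume_ge0.
  exact: nneseries_lim_ge.
have F_ge0 y : (0 <= F y)%E by apply: le_trans (t_leF 0%N y).
pose B := D `&` [set y | (F y < +oo)%E].
have mB : measurable B by exact: emeasurable_fun_infty_o.
have Bcvg y : B y -> exists2 l, x j y @[j --> \oo] --> l &
    forall j, `|x j y - l| <= Num.sqrt (fine (F y)) * rho ^+ j / (1 - rho).
  move=> [Dy Fy]; apply: geometric_cauchy; first by rewrite ltW.
  move=> j; have := t_leF j y.
  rewrite -[F y]fineK ?ge0_fin_numE// lee_fin mulrC -ler_pdivlMr ?invr_gt0 ?exprn_gt0//.
  rewrite invrK => dF; rewrite -/(d j y) -(sqrtr_sqr (d j y)).
  apply: (le_trans (ler_wsqrtr dF)).
  rewrite sqrtrM ?fine_ge0// -exprM mulnC exprM sqrtr_sqr.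
  by rewrite ger0_norm// exprn_ge0// ltW.
(* cut off where F is infinite, so as to converge everywhere *)
pose h j y := \1_B y * x j y.
have hcvg y : D y -> cvgn (h ^~ y).
  move=> Dy; have [yB|yB] := boolP (y \in B).
    have [l hl _] := Bcvg y (set_mem yB).
    apply/cvg_ex; exists l; rewrite /h indicE yB/=.
    by under eq_fun do rewrite mul1r.
  apply/cvg_ex; exists 0; rewrite /h indicE (negbTE yB)/=.
  by under eq_fun do rewrite mul0r; exact: cvg_cst.
pose w y := limn (h ^~ y).
have mw : measurable_fun D w.
  apply: (@measurable_fun_cvg _ _ _ _ h) => [j|y Dy]; last exact: hcvg.
  apply: measurable_funM; first exact: measurable_indic.
  by case: (Lx j).
pose c := (1 - rho) ^- 2.
have c_gt0 : 0 < c by rewrite invr_gt0 exprn_gt0// subr_gt0.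
have cr_ge0 j : 0 <= c * (rho ^+ 2) ^+ j.
  by apply: mulr_ge0; [exact: ltW|apply: exprn_ge0; exact: ltW].
have pw j y : D y -> (((x j y - w y) ^+ 2)%:E <= (c * (rho ^+ 2) ^+ j)%:E * F y)%E.
  move=> Dy; have k_gt0 : 0 < c * (rho ^+ 2) ^+ j by rewrite mulr_gt0// exprn_gt0.
  have [yB|yB] := pselect (B y).
    have [l hl lej] := Bcvg y yB.
    have -> : w y = l.
      apply: cvg_lim => //; rewrite /h indicE mem_set//=.
      by under eq_fun do rewrite mul1r.
    rewrite -[F y]fineK; last by rewrite ge0_fin_numE//; case: yB.
    rewrite -EFinM lee_fin -(real_normK (num_real _)).
    apply: (@le_trans _ _ ((Num.sqrt (fine (F y)) * rho ^+ j / (1 - rho)) ^+ 2)).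
      by rewrite lerXn2r// nnegrE (le_trans _ (lej j)).
    rewrite ![in leLHS]exprMn sqr_sqrtr ?fine_ge0// exprVn -/c.
    have -> : rho ^+ j ^+ 2 = (rho ^+ 2) ^+ j by rewrite -!exprM mulnC.
    rewrite le_eqVlt; apply/orP; left; apply/eqP.
    by rewrite [LHS]mulrC (mulrC (fine _)) mulrA.
  have -> : F y = +oo%E.
    by apply: contra_notP yB => Fy; split => //=; rewrite ltey; exact/eqP.
  by rewrite gt0_muley ?lte_fin// leey.
have mxw j : measurable_fun D (fun y => x j y - w y).
  by apply: measurable_funB => //; case: (Lx j).
have sq_le j : (sqnorm D (fun y => x j y - w y)%R <=
    (c * (rho ^+ 2) ^+ j * (C / (1 - q)))%:E)%E.
  rewrite EFinM; apply: (@le_trans _ _ ((c * (rho ^+ 2) ^+ j)%:E * \int[leb]_(y in D) F y)%E).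
    rewrite -ge0_integralZl_EFin//.
    apply: ge0_le_integral => //.
    - by move=> y _; rewrite lee_fin sqr_ge0.
    - by apply/measurable_EFinP; exact: measurable_funX.
    - exact: measurable_funeM.
    - by move=> y Dy; exact: pw.
  by rewrite lee_pmul ?lee_fin// integral_ge0.
have Lxw j : L2 D (fun y => x j y - w y).
  by split => //; apply: (le_lt_trans (sq_le j)); rewrite ltry.
exists w.
  have := L2B _ _ (Lx 0%N) (Lxw 0%N); congr (L2 D _).
  by apply/funext => y; rewrite opprB addrC subrK.
apply: (@squeeze_cvgr _ _ _ _ (fun=> 0) (fun j => c * (C / (1 - q)) * (rho ^+ 2) ^+ j)).
- apply: nearW => j; rewrite dotp_ge0/=.
  by have := sq_le j; rewrite sqnormE// lee_fin mulrAC.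
- exact: cvg_cst.
- rewrite -[X in _ --> X](mulr0 (c * (C / (1 - q)))); apply: cvgMl_tmp.
  apply: cvg_expr; rewrite ger0_norm ?sqr_ge0// expr_lt1//.
  exact: ltW.
Qed.

End L2_complete.

(** * Cubes and Borel sets of R^n *)

Section rV_measure.
Context {R : realType}.
Implicit Types n : nat.

Definition cube {n} (c : 'rV[R]_n) (r : R) : set 'rV[R]_n :=
  [set x | forall i, `|x ord0 i - c ord0 i| < r].

Lemma measurable_cube n (c : 'rV[R]_n) r : measurable (cube c r).
Proof.
rewrite (_ : cube c r = \bigcap_(i in [set: 'I_n])
    (@rV_coor R n i @^-1` (ball (c ord0 i) r))); last first.
  apply/seteqP; split => x.
    by move=> cx /= i _; rewrite /rV_coor -ball_normE/= distrC.
  by move=> cx i; have := cx i I; rewrite /rV_coor -ball_normE/= distrC.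
apply: fin_bigcap_measurable => // i _.
rewrite -[X in measurable X]setTI; apply: measurable_rV_coor => //.
exact: measurable_ball.
Qed.

Lemma nbhs_cubeP n (x : 'rV[R]_n) (U : set 'rV[R]_n) : nbhs x U <->
  exists2 e, 0 < e & cube x e `<=` U.
Proof.
split=> [/nbhs_ballP[e /= e0 eU]|[e e0 eU]].
  exists e => // y xy; apply: eU; split => // i j.
  by rewrite ord1 -ball_normE/= distrC.
apply/nbhs_ballP; exists e => //= y [_ xy]; apply: eU => i.
by have := xy ord0 i; rewrite -ball_normE/= distrC.
Qed.

Lemma subset_cube n (c d : 'rV[R]_n) r e :
  (forall i, `|d ord0 i - c ord0 i| + e <= r) -> cube d e `<=` cube c r.
Proof.
move=> h x dx i; apply: lt_le_trans (h i).
rewrite (_ : _ - c ord0 i = (d ord0 i - c ord0 i) + (x ord0 i - d ord0 i)); last first.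
  by rewrite [RHS]addrC addrA subrK.
by apply: (le_lt_trans (ler_normD _ _)); rewrite ltrD2l.
Qed.

Lemma open_cube n (c : 'rV[R]_n) r : open (cube c r).
Proof.
rewrite openE => x cx; apply/nbhs_cubeP.
case: n c x cx => [|n] c x cx.
  by exists 1 => // y _ [].
have [i _ hi] := @arg_minP _ _ _ ord0 xpredT
  (fun i : 'I_n.+1 => r - `|x ord0 i - c ord0 i|) isT.
exists (r - `|x ord0 i - c ord0 i|); first by rewrite subr_gt0.
by apply: subset_cube => // j; rewrite addrC -lerBrDr; exact: hi.
Qed.

(** An open set is the union of the cubes with rational center and radius
   that it contains. *)
Lemma open_measurable_rV n (U : set 'rV[R]_n) : open U -> measurable U.
Proof.
move=> oU.
pose B (p : 'rV[rat]_n * rat) := cube (map_mx (@ratr R) p.1) (ratr p.2).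
rewrite (_ : U = \bigcup_(p in [set p | B p `<=` U]) B p).
  rewrite bigcup_mkcond; apply: countable_bigcupT_measurable; first exact: countableP.
  by move=> p; case: ifP => _; [exact: measurable_cube|exact: measurable0].
apply/seteqP; split => [x Ux|x [p /= pU]]; last exact: pU.
have [e e0 eU] := (nbhs_cubeP x U).1 (open_nbhs_nbhs (conj oU Ux)).
have [r /andP[r0 re]] : exists r : rat, 0 < (ratr r : R) < e / 2.
  have [r] := @rat_in_itvoo R 0 (e / 2) (divr_gt0 e0 (ltr0Sn _ _)).
  by rewrite in_itv/=; exists r.
have hq i : exists q : rat, `|x ord0 i - ratr q| < ratr r.
  have [|q] := @rat_in_itvoo R (x ord0 i) (x ord0 i + ratr r); first by rewrite ltrDl.
  by rewrite in_itv/= => /andP[q1 q2]; exists q; rewrite ltr_norml; apply/andP; split; lra.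
have [q hq'] := choice hq.
exists (\row_i q i, r).
  move=> y /= yB; apply: eU => i; have := yB i; have := hq' i; rewrite !mxE.
  by rewrite !ltr_norml => /andP[? ?] /andP[? ?]; apply/andP; split; lra.
by move=> i /=; rewrite !mxE.
Qed.

Lemma continuous_measurable_rV n (D : set 'rV[R]_n) (f : 'rV[R]_n -> R) : open D ->
  (forall x, D x -> {for x, continuous f}) -> measurable_fun D f.
Proof.
move=> oD cf; apply: (measurability (@RGenOInfty.G R) (RGenOInfty.measurableE R)).
move=> _ [_ [a ->] <-]; apply: open_measurable_rV.
rewrite openE => x [Dx /= fx]; apply: filterI.
  exact: open_nbhs_nbhs.
apply: (cf x Dx); apply: open_nbhs_nbhs; split => //.
Qed.

Lemma lebesgue_cube n (c : 'rV[R]_n) r : 0 <= r ->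
  lebesgue_rV R n (cube c r) = ((2 * r) ^+ n)%:E.
Proof.
move=> r0; elim: n c => [|n IHn] c.
  rewrite (_ : cube c r = setT) ?lebesgue_rV0//.
  by apply/seteqP; split => // x _ [].
pose c' : 'rV[R]_n := \row_j c ord0 (lift ord0 j).
rewrite (_ : cube c r = [set x | ball (c ord0 ord0) r (x ord0 ord0) /\
    cube c' r (\row_j x ord0 (lift ord0 j))]); last first.
  apply/seteqP; split => x.
    by move=> cx; split; [rewrite -ball_normE/= distrC|move=> j; rewrite !mxE].
  move=> [c0 cj] i; have [j|->] := unliftP ord0 i.
    by move=> ->; have := cj j; rewrite !mxE.
  by move: c0; rewrite -ball_normE/= distrC.
rewrite lebesgue_rVS ?IHn//; [|exact: measurable_ball|exact: measurable_cube].
rewrite lebesgue_measure_ball// -EFinM exprS; congr (_ * _)%:E.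
by rewrite mulr2n mulrDl mul1r.
Qed.

End rV_measure.

(** * The integral of a partial derivative *)

Section directional.
Context {R : realType}.

(** A directional derivative only depends on the restriction to a line, so it
   can be transported along any map g that is affine in the direction w. *)
Lemma derive_along (V V' : normedModType R) (f : V -> R) (g : V' -> V) (v : V) (w : V')
    (a : V') : (forall h, g (h *: w + a) = h *: v + g a) ->
  'D_w (f \o g) a = 'D_v f (g a) /\
  (derivable f (g a) v -> derivable (f \o g) a w).
Proof.
move=> gE; rewrite /derive /derivable.
have -> : (fun h => h^-1 *: (((f \o g) \o shift a) (h *: w) - (f \o g) a)) =
    (fun h => h^-1 *: ((f \o shift (g a)) (h *: v) - f (g a))) :> (R -> R).
  by apply/funext => h /=; rewrite gE.
by [].
Qed.

Lemma continuous_bounded_on (T : topologicalType) (K : set T) (f : T -> R) :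
  compact K -> (forall x, K x -> {for x, continuous f}) ->
  exists2 M, 0 < M & forall x, K x -> `|f x| <= M.
Proof.
move=> cK cf.
have cf' : {within K, continuous f}.
  by apply: continuous_in_subspaceT => x /set_mem; exact: cf.
have /ex_strict_bound_gt0[M M0 hM] := compact_bounded (continuous_compact cf' cK).
by exists M => // x Kx; apply/ltW/hM; exact: imageP.
Qed.

End directional.

Section divergence.
Context {R : realType}.

Lemma continuous_cons_l n (v : 'rV[R]_n) :
  continuous (fun t : R => cons_rV (t, v) : 'rV[R]_n.+1).
Proof.
move=> t U /nbhs_cubeP[e e0 eU].
apply/nbhs_ballP; exists e => //= s ts; apply: eU => i; rewrite !mxE.
case: unliftP => [j _|_] /=; first by rewrite subrr normr0.
by move: ts; rewrite -ball_normE/= distrC.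
Qed.

Lemma continuous_cons_r n (t : R) :
  continuous (fun v : 'rV[R]_n => cons_rV (t, v) : 'rV[R]_n.+1).
Proof.
move=> v U /nbhs_cubeP[e e0 eU].
apply/nbhs_cubeP; exists e => //= w vw; apply: eU => i; rewrite !mxE.
by case: unliftP => [j _|_] /=; [exact: vw|rewrite subrr normr0].
Qed.

Lemma compact_closed_cube n (c : 'rV[R]_n) r :
  compact [set x : 'rV[R]_n | forall i, `|x ord0 i - c ord0 i| <= r].
Proof.
rewrite (_ : [set x | _] = [set x : 'rV[R]_n |
    forall i, `[c ord0 i - r, c ord0 i + r]%classic (x ord0 i)]).
  apply: (@rV_compact _ _ (fun i => `[c ord0 i - r, c ord0 i + r]%classic)).
  by move=> i; exact: segment_compact.
by apply/seteqP; split => x /= h i; have := h i; rewrite /= in_itv/= ler_distl.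
Qed.

Lemma cube_bounded n (g : 'rV[R]_n -> R) c r : continuous g ->
  (forall x, ~ cube c r x -> g x = 0) -> exists2 M, 0 < M & forall x, `|g x| <= M.
Proof.
move=> cg g0.
have [M M0 hM] := continuous_bounded_on (@compact_closed_cube n c r) (fun x _ => cg x).
exists M => // x; have [cx|cx] := pselect (cube c r x).
  by apply: hM => i; apply: ltW; exact: cx.
by rewrite g0// normr0 ltW.
Qed.

Lemma bounded_support_integrable n (g : 'rV[R]_n -> R) c r : continuous g ->
  (forall x, ~ cube c r x -> g x = 0) ->
  (lebesgue_rV R n).-integrable setT (EFin \o g).
Proof.
move=> cg g0; have [M M0 hM] := cube_bounded cg g0.
have mg : measurable_fun setT g.
  by apply: continuous_measurable_rV => [|x _]; [exact: openT|exact: cg].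
apply: (@le_integrable _ _ _ _ _ measurableT _ (EFin \o (fun x => M * \1_(cube c r) x))).
- exact/measurable_EFinP.
- move=> x _ /=; rewrite lee_fin [leRHS]ger0_norm; last by rewrite mulr_ge0 // ltW.
  rewrite indicE; have [cx|cx] := boolP (x \in cube c r); first by rewrite mulr1 hM.
  by rewrite mulr0 g0 ?normr0//; move/negP : cx; apply: contra_not => /mem_set.
- apply: (@integrableZl _ _ _ _ _ measurableT M (EFin \o \1_(cube c r))).
  apply/integrableP; split.
    by apply/measurable_EFinP/measurable_indic; exact: measurable_cube.
  rewrite (eq_integral (fun x => (\1_(cube c r) x)%:E)); last first.
    by move=> x _ /=; rewrite ger0_norm.
  rewrite integral_indic//; last exact: measurable_cube.
  rewrite setIT.
  have [r0|r0] := leP 0 r; first by rewrite [X in (X < _)%E](lebesgue_cube c r0) ltry.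
  case: n c g cg g0 hM mg => [|n] c g cg g0 hM mg.
    rewrite (_ : cube c r = setT); first by rewrite [X in (X < _)%E]lebesgue_rV0 ltry.
    by apply/seteqP; split => // x _ [].
  rewrite (_ : cube c r = set0) ?measure0//.
  by apply/seteqP; split => // x /(_ ord0); rewrite ltNge (le_trans (ltW r0) (normr_ge0 _)).
Qed.

(** The measure on R^(n+1) is by definition a pushforward of the product
   measure on R x R^n. *)
Lemma integral_rVS n (g : 'rV[R]_n.+1 -> R) :
  (lebesgue_rV R n.+1).-integrable setT (EFin \o g) -> measurable_fun setT g ->
  (\int[lebesgue_rV R n.+1]_x (g x)%:E =
   \int[lebesgue_measure \x lebesgue_rV R n]_p (g (cons_rV p))%:E)%E /\
  (lebesgue_measure \x lebesgue_rV R n)%E.-integrable setT (EFin \o (g \o @cons_rV R n)).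
Proof.
move=> ig mg.
have ig' : (lebesgue_measure \x lebesgue_rV R n)%E.-integrable setT
    (EFin \o (g \o @cons_rV R n)).
  apply/integrableP; split.
    apply/measurable_EFinP; apply: measurableT_comp => //; exact: measurable_cons_rV.
  case/integrableP : ig => _; rewrite /= /lebesgue_rV_succ.
  rewrite ge0_integral_pushforward//; first exact: measurable_cons_rV.
  by do 2 apply: measurableT_comp => //.
split => //; rewrite /= /lebesgue_rV_succ integral_pushforward//.
- exact: measurable_cons_rV.
- exact/measurable_EFinP.
Qed.

Lemma integral_derive1_eq0 (F : R -> R) (r : R) : 0 < r ->
  (forall t, derivable F t 1) -> continuous (derive1 F) ->
  (forall t, r <= `|t| -> F t = 0) ->
  (\int[lebesgue_measure]_t (derive1 F t)%:E = 0)%E.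
Proof.
move=> r0 dF cF F0.
have cFF : continuous F.
  by move=> t; apply: differentiable_continuous; exact/derivable1_diffP.
have F'0 t : r < `|t| -> derive1 F t = 0.
  move=> rt; rewrite derive1E (@near_eq_derive _ _ _ F (cst 0)) ?derive_cst//.
  near=> s; apply: F0; apply: ltW.
  near: s; apply: (cvgr_gt `|t|) => //.
  exact: norm_continuous.
pose b : R := r + 1.
have -> : (\int[lebesgue_measure]_t (derive1 F t)%:E =
    \int[lebesgue_measure]_(t in `[(- b)%R, b]) (derive1 F t)%:E)%E.
  rewrite [RHS]integral_mkcond; apply: eq_integral => t _.
  rewrite patchE; case: ifPn => // tb; rewrite F'0//.
  rewrite ltNge; apply: contra tb => tr; rewrite inE/= in_itv/=.
  by rewrite -ler_norml (le_trans tr)// lerDl.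
have b0 : 0 < b by rewrite addr_gt0.
rewrite (@continuous_FTC2 _ (derive1 F) F).
- by rewrite !F0 ?subee// ?normrN ger0_norm ?ltW// ltrDl.
- lra.
- by apply: continuous_subspaceT.
- split => //.
  + by apply: cvg_at_right_filter; exact: cFF.
  + by apply: cvg_at_left_filter; exact: cFF.
- by [].
Unshelve. all: by end_near. Qed.

(** By Fubini, integrate first in the k-th coordinate, where the fundamental
   theorem of calculus applies. In coordinates (t, v) of R x R^n, this is t if
   k = 0; otherwise the inner integral over v vanishes by induction on n. *)
Lemma integral_partial_eq0 n (f : 'rV[R]_n -> R) (k : 'I_n) r : 0 < r ->
  (forall x, derivable f x (delta_mx ord0 k)) -> continuous (partial k f) ->
  (forall x, ~ cube 0 r x -> f x = 0) ->
  (\int[lebesgue_rV R n]_x (partial k f x)%:E = 0)%E.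
Proof.
move=> r0; elim: n f k => [f [] //|n IHn f k df cdf f0].
have df0 x : ~ cube 0 (r + 1) x -> partial k f x = 0.
  move=> /existsNP[i xi]; rewrite /partial.
  rewrite (@near_eq_derive _ _ _ f (cst 0)) ?derive_cst//.
  have /(nbhs_cubeP x _).2 : exists2 e, 0 < e & cube x e `<=` [set y | f y = 0].
    exists 1 => // y xy; apply: f0 => /(_ i) yi; apply: xi.
    rewrite (_ : x ord0 i - _ = (y ord0 i - (0 : 'rV[R]_n.+1) ord0 i) -
      (y ord0 i - x ord0 i)); last by rewrite opprB; ring.
    by apply: (le_lt_trans (ler_normB _ _)); apply: ltrD; [exact: yi|exact: xy].
  by apply: filterS => y ->.
have mdf : measurable_fun setT (partial k f).
  by apply: continuous_measurable_rV => [|x _]; [exact: openT|exact: cdf].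
have idf : (lebesgue_rV R n.+1).-integrable setT (EFin \o partial k f).
  exact: (bounded_support_integrable cdf df0).
have [-> ig] := integral_rVS idf mdf.
have [j kE|kE] := unliftP ord0 k.
  rewrite -(integral12_prod_meas1 ig) integral0_eq// => t _; rewrite /fubini_F/=.
  have along v : partial j (fun w => f (cons_rV (t, w))) v = partial k f (cons_rV (t, v)) /\
      (derivable f (cons_rV (t, v)) (delta_mx ord0 k) ->
       derivable (fun w => f (cons_rV (t, w))) v (delta_mx ord0 j)).
    apply: (@derive_along _ _ _ f (fun w => cons_rV (t, w))) => h.
    apply/rowP => i; rewrite !mxE kE.
    case: (unliftP ord0 i) => [l|] -> /=; rewrite ?mxE.
      by rewrite (inj_eq lift_inj).
    by rewrite mulr0 add0r.
  rewrite -[RHS](IHn (fun w => f (cons_rV (t, w))) j).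
  - by apply: eq_integral => v _; rewrite (along v).1.
  - by move=> v; exact: (along v).2.
  - rewrite (_ : partial j _ = partial k f \o (fun v => cons_rV (t, v))).
      move=> v; apply: continuous_comp; last exact: cdf.
      exact: continuous_cons_r.
    by apply/funext => v; rewrite (along v).1.
  - move=> v vr; apply: f0 => h; apply: vr => i.
    by have := h (lift ord0 i); rewrite !mxE liftK.
rewrite -(integral21_prod_meas1 ig) integral0_eq// => v _; rewrite /fubini_G/=.
have along t : 'D_1 (fun s : R => f (cons_rV (s, v))) t = partial k f (cons_rV (t, v)) /\
    (derivable f (cons_rV (t, v)) (delta_mx ord0 k) ->
     derivable (fun s : R => f (cons_rV (s, v))) t 1).
  apply: (@derive_along _ _ _ f (fun s : R => cons_rV (s, v))) => h.
  apply/rowP => i; rewrite !mxE kE.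
  case: (unliftP ord0 i) => [l|] -> /=; rewrite ?mxE.
    by rewrite mulr0 add0r.
  by rewrite ?eqxx.
have dE : partial k f \o (fun t : R => cons_rV (t, v)) = derive1 (fun s : R => f (cons_rV (s, v))).
  by apply/funext => t; rewrite derive1E (along t).1.
rewrite -[RHS](@integral_derive1_eq0 (fun s : R => f (cons_rV (s, v))) r r0).
- by rewrite -dE.
- by move=> t; exact: (along t).2.
- rewrite -dE => t; apply: continuous_comp; last exact: cdf.
  exact: continuous_cons_l.
- move=> t rt; apply: f0 => /(_ ord0); rewrite !mxE unlift_none subr0.
  by rewrite ltNge rt.
Qed.

End divergence.

(** * Smooth functions *)

Section smooth_calculus.
Context {R : realType} {n : nat}.
Local Notation E := 'rV[R]_n.
Implicit Types (W U : set E) (f g : E -> R).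

Lemma near_open U (P : E -> Prop) x : open U -> U x -> (forall y, U y -> P y) ->
  \forall y \near x, P y.
Proof. by move=> oU Ux UP; apply: filterS (open_nbhs_nbhs (conj oU Ux)). Qed.

Lemma partial_eq_on U f g i x : open U -> (forall y, U y -> f y = g y) -> U x ->
  partial i f x = partial i g x.
Proof. by move=> oU fg Ux; apply: near_eq_derive; exact: near_open oU Ux fg. Qed.

Lemma derivable_eq_on U f g v x : open U -> (forall y, U y -> f y = g y) -> U x ->
  derivable f x v -> derivable g x v.
Proof. by move=> oU fg Ux; apply: near_eq_derivable; exact: near_open oU Ux fg. Qed.

Lemma continuous_eq_on U f g x : open U -> (forall y, U y -> f y = g y) -> U x ->
  {for x, continuous f} -> {for x, continuous g}.
Proof.
move=> oU fg Ux cf; rewrite /prop_for /continuous_at -(fg _ Ux).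
apply: cvg_trans cf; apply: (near_eq_cvg (F := nbhs x)).
by have := near_open oU Ux fg; apply: filterS => y ->.
Qed.

(** A coinduction principle: as smoothness is about the partial derivatives of
   all orders, it is enough to exhibit a class of functions with continuous
   values and partial derivatives, stable under these up to equality on W. *)
Lemma smooth_coind W (P : (E -> R) -> Prop) : open W ->
  (forall f, P f ->
     (forall x, W x -> {for x, continuous f} /\
                       forall i, derivable f x (delta_mx ord0 i)) /\
     forall i, exists2 g, P g & forall x, W x -> partial i f x = g x) ->
  forall f, P f -> smooth_on W f.
Proof.
move=> oW hP f Pf.
have iterP s : exists2 g, P g & forall x, W x -> g x = iter_partial s f x.
  elim: s => [|i s [g Pg gs]]; first by exists f.
  have [g' Pg' gg'] := (hP _ Pg).2 i.
  exists g' => // x Wx; rewrite -gg'//=; exact: partial_eq_on oW gs Wx.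
move=> s x Wx; have [g Pg gs] := iterP s; have [gx dgx] := (hP _ Pg).1 x Wx.
split; first exact: continuous_eq_on oW gs Wx gx.
by move=> i; exact: derivable_eq_on oW gs Wx (dgx i).
Qed.

Lemma smooth_partial W f i : smooth_on W f -> smooth_on W (partial i f).
Proof.
move=> sf s x Wx; have := sf (rcons s i) x Wx.
by rewrite /iter_partial -cats1 foldr_cat.
Qed.

Lemma smooth_eq_on W f g : open W -> (forall x, W x -> f x = g x) ->
  smooth_on W f -> smooth_on W g.
Proof.
move=> oW fg sf.
apply: (@smooth_coind W (fun g => exists2 f, smooth_on W f & forall x, W x -> f x = g x)) => //.
  move=> {sf fg} h [k sk kh]; split.
    move=> x Wx; have [kx dkx] := sk [::] x Wx; split.
      exact: continuous_eq_on oW kh Wx kx.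
    by move=> i; exact: derivable_eq_on oW kh Wx (dkx i).
  move=> i; exists (partial i k).
    by exists (partial i k); [exact: smooth_partial|move=> x _].
  by move=> x Wx; apply/esym; exact: partial_eq_on oW kh Wx.
by exists f.
Qed.

(** Sums and products are treated together, because the Leibniz rule takes
   products to sums of products. *)
Inductive smooth_alg W : (E -> R) -> Prop :=
| SmoothBase f : smooth_on W f -> smooth_alg W f
| SmoothAdd f g : smooth_alg W f -> smooth_alg W g -> smooth_alg W (fun x => f x + g x)
| SmoothMul f g : smooth_alg W f -> smooth_alg W g -> smooth_alg W (fun x => f x * g x).

Lemma smooth_algP W f : open W -> smooth_alg W f -> smooth_on W f.
Proof.
move=> oW; apply: smooth_coind => // {}f; elim.
- move=> {}f sf; split; first exact: (sf [::]).
  by move=> i; exists (partial i f) => //; apply: SmoothBase; exact: smooth_partial.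
- move=> {}f g Pf [IHf IHf'] Pg [IHg IHg']; split.
    move=> x Wx; have [cf df] := IHf x Wx; have [cg dg] := IHg x Wx.
    by split; [exact: (cvgD cf cg)|move=> i; exact: (derivableD (df i) (dg i))].
  move=> i; have [f' Pf' ff'] := IHf' i; have [g' Pg' gg'] := IHg' i.
  exists (fun x => f' x + g' x); first exact: SmoothAdd.
  move=> x Wx; rewrite -ff'// -gg'//; apply: deriveD; first exact: (IHf x Wx).2.
  exact: (IHg x Wx).2.
- move=> {}f g Pf [IHf IHf'] Pg [IHg IHg']; split.
    move=> x Wx; have [cf df] := IHf x Wx; have [cg dg] := IHg x Wx.
    by split; [exact: (cvgM cf cg)|move=> i; exact: (derivableM (df i) (dg i))].
  move=> i; have [f' Pf' ff'] := IHf' i; have [g' Pg' gg'] := IHg' i.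
  exists (fun x => f x * g' x + g x * f' x).
    by apply: SmoothAdd; exact: SmoothMul.
  move=> x Wx; rewrite -ff'// -gg'//; apply: deriveM; first exact: (IHf x Wx).2.
  exact: (IHg x Wx).2.
Qed.

Lemma smoothD W f g : open W -> smooth_on W f -> smooth_on W g ->
  smooth_on W (fun x => f x + g x).
Proof. by move=> *; apply: smooth_algP => //; apply: SmoothAdd; exact: SmoothBase. Qed.

Lemma smoothM W f g : open W -> smooth_on W f -> smooth_on W g ->
  smooth_on W (fun x => f x * g x).
Proof. by move=> *; apply: smooth_algP => //; apply: SmoothMul; exact: SmoothBase. Qed.

Lemma smooth_cst W (c : R) : open W -> smooth_on W (fun=> c).
Proof.
move=> oW; apply: (@smooth_coind W (fun f => exists c, f = fun=> c)) => //; last by exists c.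
move=> _ [d ->]; split.
  by move=> x _; split; [exact: cst_continuous|move=> i; exact: derivable_cst].
by move=> i; exists (fun=> 0); [exists 0|move=> x _; exact: derive_cst].
Qed.

Lemma smooth_prod W (I : Type) (r : seq I) (F : I -> E -> R) : open W ->
  (forall i, smooth_on W (F i)) -> smooth_on W (fun x => \prod_(i <- r) F i x).
Proof.
move=> oW sF; elim: r => [|i r IHr].
  have -> : (fun x => \prod_(i <- [::]) F i x) = (fun=> 1).
    by apply/funext => x; rewrite big_nil.
  exact: smooth_cst.
have -> : (fun x => \prod_(j <- i :: r) F j x) = fun x => F i x * \prod_(j <- r) F j x.
  by apply/funext => x; rewrite big_cons.
exact: (smoothM oW (sF i) IHr).
Qed.

Lemma partialM f g i x : derivable f x (delta_mx ord0 i) -> derivable g x (delta_mx ord0 i) ->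
  partial i (fun y => f y * g y) x = f x * partial i g x + g x * partial i f x.
Proof. by move=> df dg; exact: (deriveM df dg). Qed.

Lemma partial_mvt f (k : 'I_n) y (t : R) :
  (forall s, `|s| <= `|t| -> derivable f (s *: delta_mx ord0 k + y) (delta_mx ord0 k)) ->
  exists2 s, `|s| <= `|t| &
    f (t *: delta_mx ord0 k + y) - f y = t * partial k f (s *: delta_mx ord0 k + y).
Proof.
move=> df; pose phi (s : R) := f (s *: delta_mx ord0 k + y).
have phi' s : `|s| <= `|t| ->
    is_derive s (1 : R) phi (partial k f (s *: delta_mx ord0 k + y)).
  move=> st; have [dE dd] := @derive_along R _ _ f
    (fun s : R => s *: delta_mx ord0 k + y) (delta_mx ord0 k) 1 s
    (fun h => ltac:(by rewrite [h *: 1]mulr1 scalerDl addrA)).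
  by rewrite /partial -dE; apply: derivableP; apply: dd; exact: df.
have cphi a b : (forall s, a <= s <= b -> `|s| <= `|t|) ->
    {within `[a, b], continuous phi}.
  move=> ab; apply: continuous_in_subspaceT => s; rewrite inE/= in_itv/= => sab.
  apply: differentiable_continuous; apply/derivable1_diffP.
  by have [] := phi' s (ab _ sab).
have phi0 : f y = phi 0 by rewrite /phi scale0r add0r.
have [t0|t0] := leP 0 t.
  have h s : 0 <= s <= t -> `|s| <= `|t|.
    by move=> /andP[s0 st]; rewrite !ger0_norm.
  have [s] := @MVT_segment R phi _ 0 t t0 (fun s hs => phi' s (h s (ltac:(
    by move: hs; rewrite in_itv/= => /andP[/ltW -> /ltW ->]))))  (cphi _ _ h).
  rewrite in_itv/= => sab phiE; exists s; first exact: h.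
  by rewrite phi0 -/(phi t) phiE subr0 mulrC.
have h s : t <= s <= 0 -> `|s| <= `|t|.
  by move=> /andP[ts s0]; rewrite !ler0_norm ?lerN2// ltW.
have [s] := @MVT_segment R phi _ t 0 (ltW t0) (fun s hs => phi' s (h s (ltac:(
    by move: hs; rewrite in_itv/= => /andP[/ltW -> /ltW ->]))))  (cphi _ _ h).
rewrite in_itv/= => sab phiE; exists s; first exact: h.
by rewrite phi0 -/(phi t) -opprB phiE sub0r mulrN opprK mulrC.
Qed.

(** Continuous partial derivatives imply differentiability along any v: go
   from x to x + h v by changing one coordinate at a time, and apply the mean
   value theorem to each step. *)
Lemma derive_sum_partial U f x v : open U -> U x ->
  (forall y, U y -> forall i, derivable f y (delta_mx ord0 i)) ->
  (forall i, {for x, continuous (partial i f)}) ->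
  derivable f x v /\ 'D_v f x = \sum_(i < n) v ord0 i * partial i f x.
Proof.
move=> oU Ux df cdf.
pose w k : E := \row_(i < n) (if (i < k)%N then v ord0 i else 0).
pose L k := \sum_(i < n | (i < k)%N) v ord0 i * partial i f x.
have incr k (e : R) : 0 < e -> exists2 d, 0 < d & forall h, `|h| < d ->
    `|f (h *: w k + x) - f x - h * L k| <= e * `|h|.
  elim: k e => [|k IHk] e e0.
    exists 1 => // h _; rewrite /L big_pred0// mulr0 subr0.
    rewrite (_ : w 0%N = 0); last by apply/rowP => i; rewrite !mxE.
    by rewrite scaler0 add0r subrr normr0 mulr_ge0// ltW.
  have [kn|kn] := ltnP k n; last first.
    rewrite (_ : w k.+1 = w k); last first.
      by apply/rowP => i; rewrite !mxE !(leq_trans (ltn_ord i))// ltnW.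
    rewrite (_ : L k.+1 = L k); first exact: IHk.
    by apply: eq_bigl => i; rewrite !(leq_trans (ltn_ord i))// ltnW.
  pose ko := Ordinal kn.
  have wS : w k.+1 = v ord0 ko *: delta_mx ord0 ko + w k.
    apply/rowP => i; rewrite !mxE eqxx/= ltnS leq_eqVlt.
    rewrite -(inj_eq val_inj i ko)/=.
    by case: ltngtP => [ik|ik|ik]; rewrite ?mulr1 ?mulr0 ?addr0 ?add0r//;
      congr (v _ _); exact/val_inj.
  have LS : L k.+1 = v ord0 ko * partial ko f x + L k.
    rewrite /L (bigD1 ko)/=; last by rewrite ltnSn.
    congr (_ + _); apply: eq_bigl => i; rewrite ltnS leq_eqVlt -(inj_eq val_inj i ko)/=.
    by case: ltngtP.
  pose vk := v ord0 ko.
  have vk1 : 0 < `|vk| + 1 by rewrite ltr_wpDl.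
  pose e' := e / 2 / (`|vk| + 1).
  have e'0 : 0 < e' by rewrite !divr_gt0.
  have [d d0 hd] : exists2 d, 0 < d & cube x d `<=`
      [set y | U y /\ `|partial ko f y - partial ko f x| < e'].
    apply/nbhs_cubeP; apply: filterI; first exact: open_nbhs_nbhs.
    have /cvgrPdist_lt/(_ _ e'0) := cdf ko.
    by apply: filterS => y; rewrite distrC.
  pose M := 1 + \sum_(i < n) `|v ord0 i|.
  have M0 : 0 < M by rewrite ltr_pwDl// sumr_ge0.
  have vM i : `|v ord0 i| < M.
    rewrite /M (bigD1 i)//=.
    have : 0 <= \sum_(j < n | j != i) `|v ord0 j| by apply: sumr_ge0.
    by move: (\sum_(j < n | j != i) _) => S S0; lra.
  have [d1 d1_gt0 hIH'] := IHk (e / 2) (divr_gt0 e0 (ltr0Sn _ _)).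
  exists (Num.min d1 (d / M)); first by rewrite lt_min d1_gt0 divr_gt0.
  move=> h; rewrite lt_min => /andP[/hIH' hIH hsmall].
  have hM (s : R) : `|s| <= `|h * vk| -> cube x d (s *: delta_mx ord0 ko + (h *: w k + x)).
    move=> hs j; rewrite !mxE eqxx/= addrA addrK.
    have hvd l : `|h| * `|v ord0 l| < d.
      apply: (@le_lt_trans _ _ (`|h| * M)); first by rewrite ler_wpM2l// ltW.
      by rewrite -ltr_pdivlMr.
    have [jk|jk] := eqVneq j ko.
      rewrite jk/= ltnn mulr1 mulr0 addr0.
      by apply: (le_lt_trans hs); rewrite normrM; exact: hvd.
    rewrite mulr0 add0r normrM; case: ifP => _; first exact: hvd.
    by rewrite normr0 mulr0.
  have [s hs fE] := @partial_mvt f ko (h *: w k + x) (h * vk)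
    (fun s hs => df _ (hd _ (hM s hs)).1 ko).
  have -> : h *: w k.+1 + x = (h * vk) *: delta_mx ord0 ko + (h *: w k + x).
    by rewrite wS scalerDr scalerA addrA.
  rewrite (_ : _ - _ - _ = (f (h *: w k + x) - f x - h * L k) +
    h * vk * (partial ko f (s *: delta_mx ord0 ko + (h *: w k + x)) - partial ko f x)); last first.
    by rewrite mulrBr -fE LS -/vk; ring.
  apply: (le_trans (ler_normD _ _)); rewrite (splitr e) mulrDl lerD//.
  rewrite !normrM -mulrA mulrC ler_wpM2r//.
  have := (hd _ (hM s hs)).2 => /ltW he.
  apply: (le_trans (ler_wpM2l (normr_ge0 _) he)).
  rewrite /e' mulrCA -[leRHS]mulr1 ler_pM2l ?divr_gt0// ler_pdivrMr// mul1r.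
  by rewrite lerDl.
have wn : w n = v by apply/rowP => i; rewrite !mxE ltn_ord.
have Ln : L n = \sum_(i < n) v ord0 i * partial i f x.
  by apply: eq_bigl => i; rewrite ltn_ord.
have lim : (fun h => h^-1 *: ((f \o shift x) (h *: v) - f x)) @ 0^' --> L n.
  apply/cvgrPdist_le => e e0; have [d d0] := incr n e e0; rewrite wn => hd.
  rewrite near_withinE; exists d => //= h; rewrite /ball_/= sub0r normrN => /hd he h0.
  rewrite distrC (_ : _ - _ = h^-1 * (f (h *: v + x) - f x - h * L n)); last first.
    by rewrite mulrBr mulrA mulVf// mul1r.
  by rewrite normrM normfV mulrC ler_pdivrMr// normr_gt0.
split; first by apply/cvg_ex; exists (L n).
by rewrite -Ln; exact: cvg_lim.
Qed.

End smooth_calculus.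

(** * Test functions and integration by parts *)

Section test_functions.
Context {R : realType} {n : nat}.
Local Notation E := 'rV[R]_n.
Local Notation leb := (lebesgue_rV R n).
Implicit Types (W D : set E) (f g phi psi : E -> R) (Y : E -> E).

Lemma rV_compact_closed (K : set E) : compact K -> closed K.
Proof. by apply: compact_closed; exact: norm_hausdorff. Qed.

(** Any compact set off which phi vanishes can stand for the support. *)
Lemma test_functionP D phi : test_function D phi <->
  smooth_on setT phi /\ exists K, [/\ compact K, K `<=` D & forall x, ~ K x -> phi x = 0].
Proof.
split=> [[sphi cK KD]|[sphi [K [cK KD phi0]]]].
  split=> //; exists (closure [set x | phi x != 0]); split => // x xK.
  apply/eqP/negP => /negP phix; apply: xK; exact: subset_closure.
have sK : closure [set x | phi x != 0] `<=` K.
  have /closure_id -> := rV_compact_closed cK.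
  by apply: closure_subset => x /= /eqP phix; apply: contrapT => /phi0.
split => //; last exact: subset_trans KD.
by apply: (subclosed_compact _ cK) => //; exact: closed_closure.
Qed.

Lemma test_function_sub D D' phi : D `<=` D' -> test_function D phi -> test_function D' phi.
Proof. by move=> DD' [? ? ?]; split => //; exact: subset_trans DD'. Qed.

Lemma test_function_off D phi x : test_function D phi -> ~ D x -> phi x = 0.
Proof. by move=> /test_functionP[_ [K [_ KD]]] + Dx; apply => /KD. Qed.

Lemma test_continuous D phi : test_function D phi -> continuous phi.
Proof. by move=> [sphi _ _] x; have [] := sphi [::] x I. Qed.

Lemma test_partial_continuous D phi i : test_function D phi -> continuous (partial i phi).
Proof. by move=> [sphi _ _] x; have [] := sphi [:: i] x I. Qed.

Lemma test_derivable D phi i x : test_function D phi -> derivable phi x (delta_mx ord0 i).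
Proof. by move=> [sphi _ _]; have [_] := sphi [::] x I; exact. Qed.

Lemma partial_off (K : set E) phi i x : closed K -> (forall x, ~ K x -> phi x = 0) ->
  ~ K x -> partial i phi x = 0.
Proof.
move=> cK phi0 Kx.
have oK : open (~` K) by rewrite openC.
rewrite (@partial_eq_on _ _ (~` K) _ (cst 0) i x)//.
exact: derive_cst.
Qed.

Lemma test_bounded_support D phi : test_function D phi ->
  exists2 r, 0 < r & forall x, ~ cube 0 r x -> phi x = 0.
Proof.
move=> /test_functionP[_ [K [cK _ phi0]]].
have hM i : exists M, 0 < M /\ forall x, K x -> `|x ord0 i| <= M.
  have [M M0 hM] := @continuous_bounded_on R _ K (fun x : E => x ord0 i) cK
    (fun x _ => @coord_continuous _ _ _ ord0 i x).
  by exists M.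
have [M hM'] := choice hM.
exists (1 + \sum_(i < n) M i).
  by rewrite ltr_pwDl// sumr_ge0// => i _; apply: ltW; exact: (hM' i).1.
move=> x xr; apply: phi0 => Kx; apply: xr => i; rewrite mxE subr0.
apply: (le_lt_trans ((hM' i).2 x Kx)); rewrite (bigD1 i)//=.
have : 0 <= \sum_(j < n | j != i) M j.
  by apply: sumr_ge0 => j _; apply: ltW; exact: (hM' j).1.
by move: (\sum_(j < n | j != i) _) => S S0; lra.
Qed.

Lemma test_integrable D phi : test_function D phi -> leb.-integrable setT (EFin \o phi).
Proof.
move=> tphi; have [r r0 phi0] := test_bounded_support tphi.
exact: (bounded_support_integrable (test_continuous tphi) phi0).
Qed.

Lemma test_measurable D D' phi : test_function D phi -> measurable_fun D' phi.
Proof.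
move=> tphi; apply: (@measurable_funS _ _ _ _ setT) => //.
apply: continuous_measurable_rV => [|x _]; first exact: openT.
exact: (test_continuous tphi).
Qed.

Lemma test_linear D a phi psi : test_function D phi -> test_function D psi ->
  test_function D (fun x => a * phi x + psi x).
Proof.
move=> /test_functionP[sphi [K [cK KD phi0]]] /test_functionP[spsi [L [cL LD psi0]]].
apply/test_functionP; split.
  exact: (smoothD openT (smoothM openT (smooth_cst a openT) sphi) spsi).
exists (K `|` L); split.
- have := @bigsetU_compact _ _ (fun b : bool => if b then K else L) [:: true; false] xpredT.
  by rewrite !big_cons big_nil setU0; apply; case.
- by move=> x [/KD|/LD].
- by move=> x /not_orP[Kx Lx]; rewrite phi0// psi0// mulr0 addr0.
Qed.

Lemma test0 D : test_function D (fun=> 0).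
Proof.
apply/test_functionP; split; first by apply: smooth_cst; exact: openT.
by exists set0; split => //; exact: compact0.
Qed.

Lemma test_sum D (I : Type) (r : seq I) (F : I -> E -> R) :
  (forall i, test_function D (F i)) -> test_function D (fun x => \sum_(i <- r) F i x).
Proof.
move=> tF; elim: r => [|i r IHr].
  have -> : (fun x => \sum_(i <- [::]) F i x) = (fun=> 0).
    by apply/funext => x; rewrite big_nil.
  exact: test0.
have -> : (fun x => \sum_(j <- i :: r) F j x) = fun x => 1 * F i x + \sum_(j <- r) F j x.
  by apply/funext => x; rewrite big_cons mul1r.
exact: test_linear.
Qed.

Lemma test_partial D i phi : test_function D phi -> test_function D (partial i phi).
Proof.
move=> /test_functionP[sphi [K [cK KD phi0]]]; apply/test_functionP.
split; first exact: smooth_partial.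
exists K; split => // x Kx; exact: (partial_off _ (rV_compact_closed cK) phi0).
Qed.

(** The product vanishes on the open complement of the support of phi, so it
   is smooth on the whole space although f is only smooth on W. *)
Lemma test_mul W D f phi : open W -> D `<=` W -> smooth_on W f -> test_function D phi ->
  test_function D (fun x => f x * phi x).
Proof.
move=> oW DW sf /test_functionP[sphi [K [cK KD phi0]]]; apply/test_functionP.
split; last first.
  by exists K; split => // x Kx; rewrite phi0// mulr0.
have sW : smooth_on W (fun x => f x * phi x).
  by apply: (smoothM oW sf) => s x _; exact: sphi.
have oK : open (~` K) by rewrite openC; exact: rV_compact_closed.
have sK : smooth_on (~` K) (fun x => f x * phi x).
  apply: (@smooth_eq_on _ _ _ (fun=> 0)) => //; last exact: smooth_cst.
  by move=> x Kx; rewrite phi0// mulr0.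
move=> s x _; have [Kx|Kx] := pselect (K x); last exact: sK.
by apply: sW; exact/DW/KD.
Qed.

Lemma vf_applyE D Y phi x : test_function D phi ->
  vf_apply Y phi x = \sum_(k < n) Y x ord0 k * partial k phi x.
Proof.
move=> tphi; rewrite /vf_apply.
apply: (@derive_sum_partial R n setT phi x (Y x) openT I _ _).2.
  by move=> y _ i; exact: test_derivable tphi.
by move=> i; exact: (@test_partial_continuous _ _ i tphi x).
Qed.

Lemma vf_apply_linear D Y a phi psi : test_function D phi -> test_function D psi ->
  vf_apply Y (fun x => a * phi x + psi x) =
  (fun x => a * vf_apply Y phi x + vf_apply Y psi x).
Proof.
move=> tphi tpsi; apply/funext => x.
rewrite (vf_applyE _ _ (test_linear a tphi tpsi)) (vf_applyE _ _ tphi) (vf_applyE _ _ tpsi).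
rewrite mulr_sumr -big_split; apply: eq_bigr => k _ /=.
have -> : partial k (fun x => a * phi x + psi x) x = a * partial k phi x + partial k psi x.
  have d1 := @test_derivable _ _ k x tphi; have d2 := @test_derivable _ _ k x tpsi.
  have d3 := @derivableZ _ _ _ phi a x _ d1.
  by rewrite /partial (deriveD d3 d2) (@deriveZ _ _ _ phi a x _ d1).
by ring.
Qed.

Variables (W : set E).
Hypothesis oW : open W.

Lemma test_vf_apply D Y phi : D `<=` W -> smooth_vector_field W Y ->
  test_function D phi -> test_function D (vf_apply Y phi).
Proof.
move=> DW sY tphi.
have -> : vf_apply Y phi = (fun x => \sum_(k < n) Y x ord0 k * partial k phi x).
  by apply/funext => x; exact: vf_applyE tphi.
by apply: test_sum => k; apply: (test_mul oW DW (sY k)); exact: test_partial.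
Qed.

Lemma test_vf_adjoint D Y phi : D `<=` W -> smooth_vector_field W Y ->
  test_function D phi -> test_function D (vf_adjoint Y phi).
Proof.
move=> DW sY tphi.
have -> : vf_adjoint Y phi = (fun x =>
    (-1) * (\sum_(k < n) partial k (fun y => Y y ord0 k * phi y) x) + 0).
  by apply/funext => x; rewrite /vf_adjoint mulN1r addr0.
apply: test_linear; last exact: test0.
by apply: test_sum => k; apply: test_partial; exact: (test_mul oW DW (sY k)).
Qed.

Lemma Rintegral_test D phi (A : set E) : test_function D phi -> D `<=` A ->
  \int[leb]_(x in A) phi x = \int[leb]_x phi x.
Proof.
move=> tphi DA; rewrite Rintegral_mkcond; apply: eq_Rintegral => x _.
rewrite patchE; case: ifPn => // xA; rewrite (test_function_off tphi)//.
by move=> Dx; move/negP: xA; apply; rewrite inE; exact: DA.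
Qed.

Lemma Rintegral_partial D phi k : test_function D phi -> \int[leb]_x partial k phi x = 0.
Proof.
move=> tphi; have [r r0 phi0] := test_bounded_support tphi.
rewrite /Rintegral (@integral_partial_eq0 _ _ phi k r)//.
- by move=> x; exact: test_derivable tphi.
- exact: (@test_partial_continuous _ _ k tphi).
Qed.

(** Pointwise, (Y phi) psi - phi (Y^* psi) = \sum_k d_k (phi Y_k psi), a sum of
   derivatives of test functions. *)
Lemma test_weak_derivative D Y phi : D `<=` W -> smooth_vector_field W Y ->
  test_function D phi -> weak_derivative W Y phi (vf_apply Y phi).
Proof.
move=> DW sY tphi psi tpsi.
have tphiW := test_function_sub DW tphi.
have subW : W `<=` W by [].
have sphi (f : E -> R) : test_function W f -> smooth_on W f.
  by move=> [sf _ _] s x _; exact: sf.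
have tA := test_mul oW subW (sphi _ (test_vf_apply subW sY tphiW)) tpsi.
have tB := test_mul oW subW (sphi _ tphiW) (test_vf_adjoint subW sY tpsi).
have tg k := test_mul oW subW (sphi _ tphiW) (test_mul oW subW (sY k) tpsi).
apply/eqP; rewrite -subr_eq0 (Rintegral_test tA)// (Rintegral_test tB)//.
rewrite -RintegralB//; [|exact: test_integrable tA|exact: test_integrable tB].
rewrite [X in X == _](_ : _ = \int[leb]_x (\sum_(k < n)
  partial k (fun y => phi y * (Y y ord0 k * psi y)) x)); last first.
  apply: eq_Rintegral => x _; rewrite (vf_applyE _ _ tphi) /vf_adjoint mulrN opprK mulr_suml mulr_sumr.
  rewrite -big_split; apply: eq_bigr => k _ /=.
  rewrite (@partialM _ _ phi (fun y => Y y ord0 k * psi y)); first by ring.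
    exact: test_derivable tphi.
  exact: test_derivable (test_mul oW subW (sY k) tpsi).
apply/eqP; elim: (index_enum 'I_n) => [|k s IHs].
  transitivity (\int[leb]_x (cst 0 x : R)); last by rewrite Rintegral_cst// mul0r.
  by apply: eq_Rintegral => x _; rewrite big_nil.
under eq_Rintegral do rewrite big_cons.
rewrite RintegralD//.
- by rewrite IHs (Rintegral_partial _ (tg k)) addr0.
- exact: test_integrable (@test_partial _ k _ (tg k)).
- by apply: test_integrable; apply: test_sum => j; exact: test_partial (tg j).
Qed.

Lemma test_L2 D phi (A : set E) : measurable A -> test_function D phi -> L2 A phi.
Proof.
move=> mA tphi; split; first exact: test_measurable tphi.
have sphi : smooth_on setT phi by case: tphi.
have t2 := test_mul openT (@subsetT _ D) sphi tphi.
apply: (@le_lt_trans _ _ (sqnorm setT phi)).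
  apply: ge0_subset_integral => //.
    by apply/measurable_EFinP; apply: measurable_funX; exact: test_measurable tphi.
  by move=> x _; rewrite lee_fin sqr_ge0.
have /integrableP[_] := test_integrable t2.
rewrite (eq_integral (fun x => (phi x ^+ 2)%:E))// => x _ /=.
by rewrite -expr2 ger0_norm// sqr_ge0.
Qed.

End test_functions.

(** * Green's formula *)

Section dotp_extra.
Context {R : realType} {n : nat}.
Local Notation E := 'rV[R]_n.
Variable D : set E.
Hypothesis mD : measurable D.
Implicit Types u v w : E -> R.

Lemma dotp_linear_r a u v w : L2 D u -> L2 D v -> L2 D w ->
  dotp D w (fun x => a * u x + v x) = a * dotp D w u + dotp D w v.
Proof. by move=> Lu Lv Lw; rewrite dotpC dotp_linear// !(dotpC D w). Qed.

Lemma dotpBr u v w : L2 D u -> L2 D v -> L2 D w ->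
  dotp D w (fun x => u x - v x) = dotp D w u - dotp D w v.
Proof.
move=> Lu Lv Lw; have := dotp_linear_r (-1) Lv Lu Lw.
rewrite mulN1r addrC => <-; congr dotp.
by apply/funext => x; rewrite mulN1r addrC.
Qed.

Lemma L2B u v : L2 D u -> L2 D v -> L2 D (fun x => u x - v x).
Proof.
move=> Lu Lv; have := L2_linear mD (-1) Lv Lu.
by congr (L2 D _); apply/funext => y; rewrite mulN1r addrC.
Qed.

Lemma dotp_cauchy_schwarz u v : L2 D u -> L2 D v ->
  dotp D u v ^+ 2 <= dotp D u u * dotp D v v.
Proof.
move=> Lu Lv; apply: discriminant_nonpos; first exact: dotp_ge0.
move=> t; have Luv := L2_linear mD t Lv Lu.
have := dotp_ge0 D (fun x => t * v x + u x).
rewrite (dotp_linear mD t Lv Lu Luv) (dotp_linear_r t Lv Lu Lv).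
rewrite (dotp_linear_r t Lv Lu Lu) (dotpC D v u).
by congr (_ <= _); ring.
Qed.

Lemma L2_sum (I : Type) (r : seq I) (F : I -> E -> R) :
  (forall i, L2 D (F i)) -> L2 D (fun x => \sum_(i <- r) F i x).
Proof.
move=> LF; elim: r => [|i r IHr].
  have -> : (fun x => \sum_(i <- [::]) F i x) = (fun=> 0).
    by apply/funext => x; rewrite big_nil.
  exact: L2_cst0.
have -> : (fun x => \sum_(j <- i :: r) F j x) = fun x => 1 * F i x + \sum_(j <- r) F j x.
  by apply/funext => x; rewrite big_cons mul1r.
exact: L2_linear.
Qed.

Lemma dotp_sum_l (I : Type) (r : seq I) (F : I -> E -> R) w :
  (forall i, L2 D (F i)) -> L2 D w ->
  dotp D (fun x => \sum_(i <- r) F i x) w = \sum_(i <- r) dotp D (F i) w.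
Proof.
move=> LF Lw; elim: r => [|i r IHr].
  rewrite big_nil (_ : (fun x => _) = (fun=> 0 * 0 + 0)); last first.
    by apply/funext => x; rewrite big_nil mul0r addr0.
  have L0 := L2_cst0 D.
  rewrite (dotp_linear mD 0 L0 L0 Lw) mul0r add0r /dotp.
  transitivity (\int[lebesgue_rV R n]_(x in D) (cst 0 x : R)).
    by apply: eq_Rintegral => x _; rewrite mul0r.
  by rewrite Rintegral_cst// mul0r.
rewrite big_cons -IHr -[X in X + _]mul1r -dotp_linear//; last exact: L2_sum.
by congr dotp; apply/funext => x; rewrite big_cons mul1r.
Qed.

Lemma L2_subset D' u : measurable D' -> D' `<=` D -> L2 D u -> L2 D' u.
Proof.
move=> mD' D'D [mu fu]; have mu' := measurable_funS mD D'D mu; split => //.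
apply: le_lt_trans fu; apply: ge0_subset_integral => //.
  by apply/measurable_EFinP; apply: measurable_funX.
by move=> x _; rewrite lee_fin sqr_ge0.
Qed.

Lemma dotp_subset_le D' u : measurable D' -> D' `<=` D -> L2 D u ->
  dotp D' u u <= dotp D u u.
Proof.
move=> mD' D'D Lu; rewrite -lee_fin -!sqnormE//; last exact: L2_subset Lu.
apply: ge0_subset_integral => //.
  by apply/measurable_EFinP; apply: measurable_funX; case: Lu.
by move=> x _; rewrite lee_fin sqr_ge0.
Qed.

End dotp_extra.

Section dirichlet.
Context {R : realType} {n m : nat}.
Local Notation E := 'rV[R]_n.
Variables (X : 'I_m -> E -> E) (W Omega : set E).
Hypothesis oW : open W.
Hypothesis sX : forall j, smooth_vector_field W (X j).
Hypothesis oOmega : open Omega.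
Hypothesis OmegaW : Omega `<=` W.
Let mW : measurable W. Proof. exact: open_measurable_rV. Qed.
Let mO : measurable Omega. Proof. exact: open_measurable_rV. Qed.
Implicit Types (u v f g phi psi : E -> R) (G : 'I_m -> E -> R).

Let tX j phi : test_function Omega phi -> test_function Omega (vf_apply (X j) phi).
Proof. exact: (test_vf_apply oW OmegaW (sX j)). Qed.

Lemma test_sum_adj_sq phi : test_function Omega phi ->
  test_function Omega (sum_adj_sq X phi).
Proof.
move=> tphi; apply: test_sum => j.
by apply: (test_vf_adjoint oW OmegaW (sX j)); exact: tX.
Qed.

Lemma dotp_test_subset u phi : test_function Omega phi -> dotp Omega u phi = dotp W u phi.
Proof.
move=> tphi; rewrite /dotp [LHS]Rintegral_mkcond [RHS]Rintegral_mkcond; congr Rintegral.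
apply/funext => x; rewrite !patchE.
have [xO|xO] := boolP (x \in Omega).
  by have -> : x \in W by apply/mem_set/OmegaW/set_mem.
have phi0 : phi x = 0.
  by apply: (test_function_off tphi) => /mem_set; exact/negP.
by rewrite phi0 mulr0 if_same.
Qed.

(** As X_j phi is a test function on W, it can be used in the definition of
   the weak derivatives G_j of u. *)
Lemma H1X_dotp u G phi : H1X X W u G -> test_function Omega phi ->
  dotp Omega u (sum_adj_sq X phi) = \sum_(j < m) dotp W (G j) (vf_apply (X j) phi).
Proof.
move=> [Lu HG] tphi.
rewrite (dotp_test_subset u (test_sum_adj_sq tphi)) dotpC dotp_sum_l//; last first.
  move=> j; apply: (test_L2 mW) => //.
  by apply: (test_vf_adjoint oW OmegaW (sX j)); exact: tX.
apply: eq_bigr => j _; rewrite dotpC.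
have [_ wd] := HG j; symmetry; apply: wd.
exact: (test_function_sub OmegaW (tX j tphi)).
Qed.

Lemma test_H1X phi : test_function Omega phi ->
  H1X X W phi (fun j => vf_apply (X j) phi).
Proof.
move=> tphi; split; first exact: (test_L2 mW tphi).
move=> j; split; first exact: (test_L2 mW (tX j tphi)).
exact: (test_weak_derivative oW OmegaW (sX j) tphi).
Qed.

Lemma H1X_sqnormE u G : L2 W u -> (forall j, L2 W (G j)) ->
  H1X_sqnorm W u G = (dotp W u u + \sum_(j < m) dotp W (G j) (G j))%:E.
Proof.
move=> Lu LG; rewrite /H1X_sqnorm EFinD -sumEFin sqnormE//; congr (_ + _)%E.
by apply: eq_bigr => j _; rewrite sqnormE.
Qed.

(** The approximation property of [H1X0], with the components of the norm taken
   separately and as real numbers. *)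
Definition approximable u G := forall e : R, 0 < e -> exists phi,
  [/\ test_function Omega phi,
      dotp W (fun x => u x - phi x) (fun x => u x - phi x) < e &
      forall j, dotp W (fun x => G j x - vf_apply (X j) phi x)
                       (fun x => G j x - vf_apply (X j) phi x) < e].

Lemma H1X0P u : H1X0 X W Omega u <->
  exists G, H1X X W u G /\ approximable u G.
Proof.
split=> [[G HG ap]|[G [HG ap]]].
  exists G; split => // e e0; have [phi tphi] := ap e e0.
  have Lphi j := L2B mW (HG.2 j).1 (test_L2 mW (tX j tphi)).
  have Lu := L2B mW HG.1 (test_L2 mW tphi).
  rewrite H1X_sqnormE// lte_fin => lt_e.
  have s0 : 0 <= \sum_(j < m) dotp W (fun x => G j x - vf_apply (X j) phi x)
                       (fun x => G j x - vf_apply (X j) phi x).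
    by apply: sumr_ge0 => j _; exact: dotp_ge0.
  exists phi; split => //.
    by apply: le_lt_trans lt_e; rewrite lerDl.
  move=> j; apply: le_lt_trans lt_e; rewrite (bigD1 j)//=.
  rewrite addrCA lerDl addr_ge0 ?dotp_ge0//.
  by apply: sumr_ge0 => i _; exact: dotp_ge0.
exists G => // e e0.
have m1 : 0 < (m.+1%:R : R) by [].
have [phi [tphi u_lt G_lt]] := ap (e / m.+1%:R) (divr_gt0 e0 m1).
exists phi => //; rewrite H1X_sqnormE; last 2 first.
- exact: (L2B mW HG.1 (test_L2 mW tphi)).
- by move=> j; exact: (L2B mW (HG.2 j).1 (test_L2 mW (tX j tphi))).
rewrite lte_fin; apply: (@lt_le_trans _ _ (e / m.+1%:R + \sum_(j < m) (e / m.+1%:R))).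
  by apply: ltr_leD => //; apply: ler_sum => j _; exact: ltW.
rewrite sumr_const card_ord -[X in X + _]mulr1n -mulrnDr add1n.
by rewrite -[X in X <= _]mulr_natr divfK ?gt_eqF.
Qed.

(** For a test function w this is [H1X_dotp] and the definition of the weak
   Laplacian; both sides are continuous in (w, G') for the L^2 norms. *)
Lemma energy_identity u G f w G' : H1X X W u G -> L2 Omega f ->
  weak_neg_laplacian X Omega u f -> H1X X W w G' -> approximable w G' ->
  dotp Omega f w = \sum_(j < m) dotp W (G j) (G' j).
Proof.
move=> HG Lf uf HG' ap.
have Lw : L2 Omega w by exact: (L2_subset mW mO OmegaW HG'.1).
set a := dotp Omega f w; set b := \sum_(j < m) _.
pose B := 1 + dotp Omega f f + \sum_(j < m) dotp W (G j) (G j).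
have BG j : dotp W (G j) (G j) <= B.
  rewrite /B (bigD1 j)//= addrCA lerDl !addr_ge0 ?dotp_ge0//.
  by apply: sumr_ge0 => i _; exact: dotp_ge0.
have Bf : dotp Omega f f <= B.
  have : 0 <= \sum_(j < m) dotp W (G j) (G j) by apply: sumr_ge0 => i _; exact: dotp_ge0.
  by rewrite /B; lra.
have B0 : 0 <= B by exact: le_trans (dotp_ge0 _ _) Bf.
have key e : 0 < e -> `|a - b| <= m.+1%:R * Num.sqrt (B * e).
  move=> e0; have [phi [tphi w_lt G_lt]] := ap e e0.
  have Lphi := test_L2 mO tphi.
  have fphi : dotp Omega f phi = \sum_(j < m) dotp W (G j) (vf_apply (X j) phi).
    by rewrite -(H1X_dotp HG tphi); exact: uf.
  have Lwp := L2B mW HG'.1 (test_L2 mW tphi).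
  have LGp j := L2B mW (HG'.2 j).1 (test_L2 mW (tX j tphi)).
  have -> : a - b = dotp Omega f (fun x => w x - phi x) -
      \sum_(j < m) dotp W (G j) (fun x => G' j x - vf_apply (X j) phi x).
    rewrite dotpBr// fphi [X in _ = _ - X](eq_bigr (fun j => dotp W (G j) (G' j) -
      dotp W (G j) (vf_apply (X j) phi))); last first.
      move=> j _; rewrite dotpBr//; first exact: (HG'.2 j).1.
      - exact: (test_L2 mW (tX j tphi)).
      - exact: (HG.2 j).1.
    by rewrite sumrB -/a -/b; ring.
  have cs (D : set E) (p q : E -> R) : measurable D -> L2 D p -> L2 D q ->
      dotp D p p <= B -> dotp D q q < e -> `|dotp D p q| <= Num.sqrt (B * e).
    move=> mD Lp Lq pB qe; rewrite -sqrtr_sqr ler_wsqrtr//.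
    apply: (le_trans (dotp_cauchy_schwarz mD Lp Lq)).
    by apply: ler_pM => //; [exact: dotp_ge0|exact: dotp_ge0|exact: ltW].
  apply: (le_trans (ler_normB _ _)).
  rewrite -natr1 mulrDl mul1r addrC lerD//.
    apply: (le_trans (ler_norm_sum _ _ _)).
    rewrite mulr_natl -[X in _ *+ X]card_ord -sumr_const.
    by apply: ler_sum => j _; apply: cs => //; exact: (HG.2 j).1.
  apply: cs => //; first exact: (L2_subset mW mO OmegaW Lwp).
  by apply: le_lt_trans w_lt; exact: dotp_subset_le.
apply/eqP; rewrite -subr_eq0 -normr_le0; apply/ler_addgt0Pr => e e0.
pose M : R := m.+1%:R ^+ 2 * (B + 1).
have M0 : 0 < M by rewrite mulr_gt0 ?exprn_gt0// ltr_wpDl.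
have := key (e ^+ 2 / M) (divr_gt0 (exprn_gt0 2 e0) M0) => /le_trans; apply.
have k0 : 0 < m.+1%:R :> R by [].
have B1 : 0 < B + 1 by rewrite ltr_wpDl.
rewrite add0r mulrC -ler_pdivlMr// -[leRHS]ger0_norm; last first.
  by apply: divr_ge0; exact: ltW.
rewrite -sqrtr_sqr ler_wsqrtr//.
have -> : B * (e ^+ 2 / M) = (e / m.+1%:R) ^+ 2 * (B / (B + 1)).
  by rewrite /M; move: (m.+1%:R : R) k0 => k k0; field; rewrite !gt_eqF.
by rewrite ler_piMr ?sqr_ge0// ler_pdivrMr// mul1r lerDl.
Qed.

End dirichlet.

(** * The graph of the Dirichlet operator *)

Section dirichlet_graph.
Context {R : realType} {n m : nat}.
Local Notation E := 'rV[R]_n.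
Variables (X : 'I_m -> E -> E) (W Omega : set E).
Hypothesis oW : open W.
Hypothesis sX : forall j, smooth_vector_field W (X j).
Hypothesis oOmega : open Omega.
Hypothesis OmegaW : Omega `<=` W.
Let mW : measurable W. Proof. exact: open_measurable_rV. Qed.
Let mO : measurable Omega. Proof. exact: open_measurable_rV. Qed.
Implicit Types (u v f g phi psi : E -> R) (G : 'I_m -> E -> R).
Let subW : W `<=` W. Proof. by []. Qed.

Lemma dirichlet_L2 u f : dirichlet_operator X W Omega u f -> L2 Omega u.
Proof. by case=> [[G [Lu _] _] _ _]; exact: (L2_subset mW mO OmegaW Lu). Qed.

Lemma dotpD_le (D : set E) a u v : measurable D -> L2 D u -> L2 D v ->
  dotp D (fun x => a * u x + v x) (fun x => a * u x + v x) <=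
  2 * a ^+ 2 * dotp D u u + 2 * dotp D v v.
Proof.
move=> mD Lu Lv; have := sqnormD_le mD a Lu Lv.
by rewrite !sqnormE//; exact: L2_linear.
Qed.

Lemma approximable_linear a u G v G' : H1X X W u G -> H1X X W v G' ->
  approximable X W Omega u G -> approximable X W Omega v G' ->
  approximable X W Omega (fun x => a * u x + v x) (fun j x => a * G j x + G' j x).
Proof.
move=> HG HG' apu apv e e0.
pose e1 := e / 4 / (a ^+ 2 + 1).
have a1 : 0 < a ^+ 2 + 1 by rewrite ltr_wpDl ?sqr_ge0.
have e10 : 0 < e1 by rewrite !divr_gt0.
have e40 : 0 < e / 4 by rewrite divr_gt0.
have [phi [tphi hu hG]] := apu _ e10; have [psi [tpsi hv hG']] := apv _ e40.
have comb (p q p' q' : E -> R) : L2 W p -> L2 W q -> L2 W p' -> L2 W q' ->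
    dotp W (fun x => p x - p' x) (fun x => p x - p' x) < e1 ->
    dotp W (fun x => q x - q' x) (fun x => q x - q' x) < e / 4 ->
    dotp W (fun x => a * p x + q x - (a * p' x + q' x))
           (fun x => a * p x + q x - (a * p' x + q' x)) < e.
  move=> Lp Lq Lp' Lq' hp hq.
  have -> : (fun x => a * p x + q x - (a * p' x + q' x)) =
      (fun x => a * (p x - p' x) + (q x - q' x)).
    by apply/funext => x; ring.
  have := dotpD_le a mW (L2B mW Lp Lp') (L2B mW Lq Lq').
  move/le_lt_trans; apply.
  have e1E : e1 * (a ^+ 2 + 1) = e / 4 by rewrite divfK// gt_eqF.
  have : a ^+ 2 * dotp W (fun x => p x - p' x) (fun x => p x - p' x) <= a ^+ 2 * e1.
    by rewrite ler_wpM2l ?sqr_ge0// ltW.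
  by rewrite mulrDr mulr1 in e1E; move: (dotp W _ _) (dotp W _ _) hp hq => P S; lra.
exists (fun x => a * phi x + psi x); split; first exact: test_linear.
- by apply: comb => //; [exact: HG.1|exact: HG'.1|exact: (test_L2 mW tphi)|exact: (test_L2 mW tpsi)].
- move=> j; rewrite (vf_apply_linear (X j) a tphi tpsi).
  apply: comb => //; [exact: (HG.2 j).1|exact: (HG'.2 j).1| |].
    exact: (test_L2 mW (test_vf_apply oW OmegaW (sX j) tphi)).
  exact: (test_L2 mW (test_vf_apply oW OmegaW (sX j) tpsi)).
Qed.

Lemma H1X_linear a u G v G' : H1X X W u G -> H1X X W v G' ->
  H1X X W (fun x => a * u x + v x) (fun j x => a * G j x + G' j x).
Proof.
move=> [Lu HG] [Lv HG']; split; first exact: L2_linear.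
move=> j; have [LG wG] := HG j; have [LG' wG'] := HG' j.
split; first exact: L2_linear.
move=> phi tphi; have Lphi := test_L2 mW tphi.
have Lad := test_L2 mW (test_vf_adjoint oW subW (sX j) tphi).
by rewrite [LHS](dotp_linear mW a LG LG' Lphi) [RHS](dotp_linear mW a Lu Lv Lad)
   /dotp (wG _ tphi) (wG' _ tphi).
Qed.

Lemma dirichlet_linear a u f v g : dirichlet_operator X W Omega u f ->
  dirichlet_operator X W Omega v g ->
  dirichlet_operator X W Omega (fun x => a * u x + v x) (fun x => a * f x + g x).
Proof.
move=> uf vg; have Lu := dirichlet_L2 uf; have Lv := dirichlet_L2 vg.
move: uf vg => [/(H1X0P oW sX OmegaW)[G [HG ap]] Lf uf].
move=> [/(H1X0P oW sX OmegaW)[G' [HG' ap']] Lg vg]; split.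
- apply/(H1X0P oW sX OmegaW); exists (fun j x => a * G j x + G' j x); split.
    exact: H1X_linear.
  exact: approximable_linear.
- exact: L2_linear.
- move=> phi tphi; have Lphi := test_L2 mO tphi.
  have Lad := test_L2 mO (test_sum_adj_sq oW sX OmegaW tphi).
  by rewrite [LHS](dotp_linear mO a Lf Lg Lphi) [RHS](dotp_linear mO a Lu Lv Lad)
     /dotp (uf _ tphi) (vg _ tphi).
Qed.

Lemma dirichlet_sym u f v g : dirichlet_operator X W Omega u f ->
  dirichlet_operator X W Omega v g -> dotp Omega f v = dotp Omega u g.
Proof.
move=> [/(H1X0P oW sX OmegaW)[G [HG ap]] Lf uf].
move=> [/(H1X0P oW sX OmegaW)[G' [HG' ap']] Lg vg].
rewrite (energy_identity oW sX oOmega OmegaW HG Lf uf HG' ap').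
rewrite dotpC (energy_identity oW sX oOmega OmegaW HG' Lg vg HG ap).
by apply: eq_bigr => j _; rewrite dotpC.
Qed.

Lemma dirichlet_null u f g : dirichlet_operator X W Omega u f -> L2 Omega g ->
  dotp Omega (fun x => f x - g x) (fun x => f x - g x) = 0 ->
  dirichlet_operator X W Omega u g.
Proof.
move=> [Hu Lf uf] Lg fg0; split => // phi tphi.
rewrite -(uf _ tphi) -!/(dotp Omega _ _).
apply: (dotp_ae mO Lg Lf (test_L2 mO tphi)).
apply: filterS (dotp_eq0_ae mO (L2B mO Lf Lg) fg0) => x /= fg /fg.
by move/eqP; rewrite subr_eq0 => /eqP.
Qed.

Lemma test_dirichlet phi : test_function Omega phi ->
  dirichlet_operator X W Omega phi (sum_adj_sq X phi).
Proof.
move=> tphi; have Hphi := test_H1X oW sX OmegaW tphi.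
have approx_self : approximable X W Omega phi (fun j => vf_apply (X j) phi).
  have d0 u : dotp W (fun x => u x - u x) (fun x => u x - u x) = 0.
    transitivity (\int[lebesgue_rV R n]_(x in W) (cst 0 x : R)).
      by apply: eq_Rintegral => x _; rewrite subrr mul0r.
    by rewrite Rintegral_cst// mul0r.
  move=> e e0; exists phi; split => //; first by rewrite d0.
  by move=> j; rewrite d0.
split.
- by apply/(H1X0P oW sX OmegaW); exists (fun j => vf_apply (X j) phi).
- exact: (test_L2 mO (test_sum_adj_sq oW sX OmegaW tphi)).
- move=> psi tpsi; rewrite -!/(dotp Omega _ _) dotpC.
  rewrite (H1X_dotp oW sX OmegaW (test_H1X oW sX OmegaW tpsi) tphi).
  rewrite (H1X_dotp oW sX OmegaW Hphi tpsi).
  by apply: eq_bigr => j _; rewrite dotpC.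
Qed.

Lemma test_energy phi : test_function Omega phi ->
  dotp Omega (sum_adj_sq X phi) phi =
  \sum_(j < m) dotp W (vf_apply (X j) phi) (vf_apply (X j) phi).
Proof.
move=> tphi; rewrite dotpC.
exact: (H1X_dotp oW sX OmegaW (test_H1X oW sX OmegaW tphi) tphi).
Qed.

End dirichlet_graph.

(** * A smooth bump function *)

Section flat_exp.
Context {R : realType}.
Implicit Types (t : R) (m : nat).

(** The powers of 1/t make the family stable under differentiation. *)
Definition flat_exp m t : R := if 0 < t then t^-1 ^+ m * expR (- t^-1) else 0.

Lemma flat_exp_le0 m t : t <= 0 -> flat_exp m t = 0.
Proof. by rewrite /flat_exp ltNge => ->. Qed.

Lemma flat_exp_gt0 m t : 0 < t -> 0 < flat_exp m t.
Proof. by move=> t0; rewrite /flat_exp t0 mulr_gt0 ?expR_gt0// exprn_gt0 ?invr_gt0. Qed.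

Lemma flat_exp_ge0 m t : 0 <= flat_exp m t.
Proof. by have [/flat_exp_le0->//|/flat_exp_gt0/ltW] := leP t 0. Qed.

(** Raise 1 + x <= exp x to the power k + 1, at x = s / (k + 1). *)
Lemma expR_ge_pow k (s : R) : 0 <= s -> (s / k.+1%:R) ^+ k.+1 <= expR s.
Proof.
move=> s0; have k0 : 0 < k.+1%:R :> R by [].
rewrite -[X in expR X](divfK (lt0r_neq0 k0)) [X in expR X]mulrC expRM_natl.
rewrite lerXn2r// ?nnegrE ?expR_ge0 ?divr_ge0//.
by apply: le_trans (expR_ge1Dx _); rewrite lerDr.
Qed.

(** This makes flat_exp differentiable at the origin. *)
Lemma flat_exp_quadratic m : exists2 C, 0 < C & forall t, flat_exp m t <= C * t ^+ 2.
Proof.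
exists (m.+2%:R ^+ m.+2); first by rewrite exprn_gt0.
move=> t; have [t0|t0] := leP t 0.
  by rewrite flat_exp_le0// mulr_ge0 ?sqr_ge0// exprn_ge0.
rewrite /flat_exp t0 expRN ler_pdivrMr ?expR_gt0//.
have := @expR_ge_pow m.+1 t^-1 (ltW _); rewrite invr_gt0 => /(_ t0).
rewrite expr_div_n ler_pdivrMr ?exprn_gt0// => h.
rewrite mulrAC -ler_pdivrMr ?exprn_gt0// -exprVn -exprD addn2 mulrC.
exact: h.
Qed.

Lemma is_derive_flat_exp m t :
  is_derive t (1 : R) (flat_exp m) (flat_exp m.+2 t - m%:R * flat_exp m.+1 t).
Proof.
have [t0|t0|t0] := ltgtP t 0.
- rewrite !flat_exp_le0 ?(ltW t0)// mulr0 subr0.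
  apply: (@near_eq_is_derive _ _ _ (cst 0)).
  near=> s; rewrite flat_exp_le0//; apply: ltW; near: s; exact: lt_nbhsl.
- have t_neq0 : t != 0 by rewrite gt_eqF.
  have dV : is_derive t (1 : R) (fun s : R => s^-1) (- t ^- 2 * 1).
    exact: is_deriveV.
  have dN : is_derive t (1 : R) (fun s : R => - s^-1) (- (- t ^- 2 * 1)) by exact: is_deriveN.
  have dE : is_derive t (1 : R) (fun s : R => expR (- s^-1)) (expR (- t^-1) * (- (- t ^- 2 * 1))).
    by apply: (@is_derive1_comp _ expR).
  have dX : is_derive t (1 : R) (fun s : R => s^-1 ^+ m) ((m%:R * t^-1 ^+ m.-1) *: (- t ^- 2 * 1)).
    case: m => [|m].
      have -> : (fun s : R => s^-1 ^+ 0) = cst 1 by apply/funext => s; rewrite expr0.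
      rewrite mul0r scale0r; exact: (is_derive_cst (1 : R) t (1 : R)).
    have -> : (fun s : R => s^-1 ^+ m.+1) = (fun s : R => s^-1) ^+ m.+1.
      by apply/funext => s; rewrite exprfctE.
    exact: is_deriveX.
  have dM : is_derive t (1 : R) (fun s : R => s^-1 ^+ m * expR (- s^-1))
      (flat_exp m.+2 t - m%:R * flat_exp m.+1 t).
    apply: (is_derive_eq (is_deriveM dX dE)).
    rewrite /flat_exp t0 /GRing.scale/= -!exprVn.
    move: (t^-1) (expR _) => s e; case: m {dV dN dE dX} => [|m] /=; rewrite ?exprS; ring.
  apply: (near_eq_is_derive _ dM).
  near=> s; rewrite /flat_exp ifT//; near: s; exact: lt_nbhsr.
- rewrite t0 !flat_exp_le0// mulr0 subr0.
  have [C C0 hC] := flat_exp_quadratic m.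
  have lim : (fun h : R => h^-1 *: ((flat_exp m \o shift 0) (h *: 1) - flat_exp m 0)) @ 0^' --> (0 : R).
    apply/cvgrPdist_le => e e0; rewrite near_withinE; exists (e / C) => /=.
      exact: divr_gt0.
    move=> h; rewrite /= sub0r normrN => he h0.
    rewrite sub0r normrN /shift/= addr0 [h *: 1]mulr1 (@flat_exp_le0 _ 0)// subr0.
    rewrite normrM normfV (ger0_norm (flat_exp_ge0 _ _)) mulrC ler_pdivrMr ?normr_gt0//.
    apply: (le_trans (hC h)); rewrite -real_normK ?num_real// expr2 mulrA.
    by rewrite ler_wpM2r// mulrC -ler_pdivlMr// ltW.
  apply: DeriveDef; first by apply/cvg_ex; exists 0.
  exact: cvg_lim.
Unshelve. all: by end_near. Qed.

Lemma flat_exp_differentiable m t : differentiable (flat_exp m) t.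
Proof. by apply/derivable1_diffP; have [] := is_derive_flat_exp m t. Qed.

End flat_exp.

Section bump.
Context {R : realType} {n : nat}.
Local Notation E := 'rV[R]_n.

(** The linear combinations of the functions flat_exp p (a x_i + b) form a
   class stable under partial derivatives, as required by [smooth_coind]. *)
Lemma smooth_flat_exp_coor (i : 'I_n) (a b : R) :
  smooth_on setT (fun x : E => flat_exp 0 (a * x ord0 i + b)).
Proof.
pose P (f : E -> R) := exists l : seq (R * nat),
  f = fun x => \sum_(p <- l) p.1 * flat_exp p.2 (a * x ord0 i + b).
pose lin (x : E) : R := a * x ord0 i + b.
have term c m x (j : 'I_n) : is_derive x (delta_mx ord0 j : E)
    (fun x : E => c * flat_exp m (lin x))
    (c * (a * (i == j)%:R) * (flat_exp m.+2 (lin x) - m%:R * flat_exp m.+1 (lin x))).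
  have [dE dd] := @derive_along R _ _ (flat_exp m) lin (a * (i == j)%:R) (delta_mx ord0 j) x
    (fun h => ltac:(by rewrite /lin !mxE eqxx/= /GRing.scale/=; ring)).
  have dif := flat_exp_differentiable m (lin x).
  have D1 : 'D_(a * (i == j)%:R) (flat_exp m) (lin x) =
      a * (i == j)%:R * (flat_exp m.+2 (lin x) - m%:R * flat_exp m.+1 (lin x)).
    rewrite deriveE// -[X in 'd _ _ X]mulr1 linearZ/= -deriveE//.
    by have [_ ->] := is_derive_flat_exp m (lin x).
  have der : derivable (flat_exp m \o lin) x (delta_mx ord0 j).
    by apply: dd; exact: diff_derivable.
  apply: (is_derive_eq (is_deriveZ c (DeriveDef der dE))).
  by rewrite D1 /GRing.scale/=; move: (_ - _) => z; ring.
have Pd (l : seq (R * nat)) x (j : 'I_n) : is_derive x (delta_mx ord0 j : E)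
    (fun x : E => \sum_(p <- l) p.1 * flat_exp p.2 (lin x))
    (\sum_(p <- l) (p.1 * (a * (i == j)%:R) *
       (flat_exp p.2.+2 (lin x) - p.2%:R * flat_exp p.2.+1 (lin x)))).
  elim: l => [|[c m] l IHl].
    rewrite big_nil (_ : (fun x => _) = cst 0); first exact: is_derive_cst.
    by apply/funext => y; rewrite big_nil.
  rewrite big_cons/= (_ : (fun x => _) = (fun x => c * flat_exp m (lin x)) +
    (fun x : E => \sum_(p <- l) p.1 * flat_exp p.2 (lin x))).
    exact: is_deriveD.
  by apply/funext => y; rewrite big_cons.
have clin x : {for x, continuous lin}.
  apply: continuousD; last exact: cst_continuous.
  by apply: continuousM; [exact: cst_continuous|exact: coord_continuous].
apply: (@smooth_coind _ _ setT P) => //; first exact: openT.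
- move=> f [l ->]; split.
    move=> x _; split; last by move=> j; have [] := Pd l x j.
    elim: l => [|[c m] l IHl].
      rewrite (_ : (fun x => _) = cst 0); first exact: cst_continuous.
      by apply/funext => y; rewrite big_nil.
    rewrite (_ : (fun x => _) = (fun x => c * flat_exp m (lin x)) \+
      (fun x : E => \sum_(p <- l) p.1 * flat_exp p.2 (lin x))); last first.
      by apply/funext => y; rewrite big_cons.
    apply: continuousD; last exact: IHl.
    apply: continuousM; first exact: cst_continuous.
    apply: continuous_comp; first exact: clin.
    exact: differentiable_continuous (flat_exp_differentiable m (lin x)).
  move=> j; exists (fun x => \sum_(p <- flatten [seq [:: (p.1 * (a * (i == j)%:R), p.2.+2);
      (- (p.1 * (a * (i == j)%:R) * p.2%:R), p.2.+1)] | p <- l])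
      p.1 * flat_exp p.2 (lin x)).
    by eexists; reflexivity.
  move=> x _; have [_ dE] := Pd l x j; rewrite /partial [LHS]dE big_flatten big_map.
  by apply: eq_bigr => p _; rewrite big_cons big_seq1/=; ring.
- exists [:: (1, 0%N)]; apply/funext => x.
  by rewrite big_seq1 mul1r.
Qed.

Definition bump (x : E) : R :=
  \prod_(i < n) (flat_exp 0 (-1 * x ord0 i + 1) * flat_exp 0 (1 * x ord0 i + 1)).

Lemma bump_smooth : smooth_on setT bump.
Proof.
apply: smooth_prod; first exact: openT.
by move=> i; apply: (smoothM openT); exact: smooth_flat_exp_coor.
Qed.

Lemma bump_off x : ~ cube 0 1 x -> bump x = 0.
Proof.
move=> /existsNP[i]; rewrite mxE subr0 => /negP; rewrite -leNgt => xi.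
rewrite /bump (bigD1 i)//= (_ : _ * flat_exp _ _ = 0) ?mul0r//.
move: xi; rewrite ler_normr => /orP[] xi.
  by rewrite flat_exp_le0 ?mul0r//; lra.
by rewrite [X in _ * X]flat_exp_le0 ?mulr0//; lra.
Qed.

Lemma bump0_gt0 : 0 < bump 0.
Proof.
apply: prodr_gt0 => i _; rewrite mxE !mulr0 add0r.
by rewrite mulr_gt0// flat_exp_gt0.
Qed.

End bump.

(** * Rayleigh quotients of small bumps *)

Section rescale.
Context {R : realType} {n : nat}.
Local Notation E := 'rV[R]_n.
Variables (s : R) (c : E).

Definition rescale (f : E -> R) : E -> R := fun x => f (s *: (x - c)).

Lemma rescale_partial f k x : smooth_on setT f ->
  derivable (rescale f) x (delta_mx ord0 k) /\
  partial k (rescale f) x = s * rescale (partial k f) x.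
Proof.
move=> sf.
have [dE dd] := @derive_along R _ _ f (fun x => s *: (x - c)) (s *: delta_mx ord0 k)
  (delta_mx ord0 k) x (fun h => ltac:(by rewrite scalerA mulrC -scalerA -scalerDr addrA)).
have df y i : derivable f y (delta_mx ord0 i) by exact: (sf [::] y I).2.
have cdf i : {for s *: (x - c), continuous (partial i f)}.
  exact: (sf [:: i] (s *: (x - c)) I).1.
have [d1 d2] := derive_sum_partial (s *: delta_mx ord0 k) openT I (fun y _ i => df y i) cdf.
split; first exact: dd.
rewrite /partial [LHS]dE d2 (bigD1 k)//= !mxE !eqxx mulr1 big1 ?addr0//.
by move=> i ik; rewrite !mxE eqxx (negbTE ik) mulr0 mul0r.
Qed.

Lemma rescale_continuous f : continuous f -> continuous (rescale f).
Proof.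
move=> cf x; have cg : {for x, continuous (fun x : E => s *: (x - c))}.
  by apply: continuousZr; apply: continuousB; [exact: id|exact: cst_continuous].
exact: (continuous_comp cg (cf _)).
Qed.

Lemma smooth_rescale f : smooth_on setT f -> smooth_on setT (rescale f).
Proof.
move=> sf; apply: (@smooth_coind _ _ setT
  (fun g => exists a f, smooth_on setT f /\ g = fun x => a * rescale f x)); first exact: openT.
- move=> _ [a [{sf}f [sf ->]]]; split.
    move=> x _; split.
      apply: continuousM; first exact: cst_continuous.
      by apply: rescale_continuous => y; exact: (sf [::] y I).1.
    by move=> i; have [df _] := rescale_partial i x sf; exact: (@derivableZ _ _ _ _ a _ _ df).
  move=> i; exists (fun x => (a * s) * rescale (partial i f) x).
    by exists (a * s), (partial i f); split; [exact: smooth_partial|].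
  move=> x _; have [df dE] := rescale_partial i x sf.
  by rewrite /partial [LHS](@deriveZ _ _ _ _ a _ _ df) -mulrA -dE.
- by exists 1, f; split => //; apply/funext => x; rewrite mul1r.
Qed.

End rescale.

Section bump_facts.
Context {R : realType} {n : nat}.
Local Notation E := 'rV[R]_n.

Lemma closed_cube_cube (c : E) r e : r < e ->
  [set x : E | forall i, `|x ord0 i - c ord0 i| <= r] `<=` cube c e.
Proof. by move=> re x xr i; exact: le_lt_trans (xr i) re. Qed.

Lemma bump_test : test_function setT (@bump R n).
Proof.
apply/test_functionP; split; first exact: bump_smooth.
exists [set x : E | forall i, `|x ord0 i - (0 : E) ord0 i| <= 1]; split => //.
  exact: compact_closed_cube.
by move=> x xK; apply: bump_off => x1; apply: xK => i; exact/ltW/x1.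
Qed.

Lemma bump_partial_bounded : exists2 K, 0 < K &
  forall k x, `|partial k (@bump R n) x| <= K.
Proof.
have hK k : exists K, 0 < K /\ forall x, `|partial k (@bump R n) x| <= K.
  have tk := @test_partial _ _ _ k _ bump_test.
  have [r r0 off] := test_bounded_support tk.
  by have [K K0 hK] := cube_bounded (test_continuous tk) off; exists K.
have [K hK'] := choice hK.
exists (1 + \sum_(k < n) K k).
  by rewrite ltr_pwDl// sumr_ge0// => k _; apply: ltW; exact: (hK' k).1.
move=> k x; apply: (le_trans ((hK' k).2 x)); rewrite (bigD1 k)//= addrCA lerDl.
by rewrite addr_ge0// sumr_ge0// => i _; apply: ltW; exact: (hK' i).1.
Qed.

Lemma bump_lower_bound : exists2 d, 0 < d & exists2 kap, 0 < kap &
  forall x, cube 0 d x -> kap <= @bump R n x.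
Proof.
have b0 := @bump0_gt0 R n.
have cb : {for (0 : E), continuous (@bump R n)} by exact: (test_continuous bump_test).
have /cvgrPdist_lt/(_ _ (divr_gt0 b0 (ltr0Sn R 1))) := cb.
move/nbhs_cubeP => [d d0 hd]; exists d => //; exists (bump (0 : E) / 2); first exact: divr_gt0.
by move=> x /hd /=; rewrite ltr_distlC => /andP[+ _]; lra.
Qed.

Variable D : set E.
Hypothesis mD : measurable D.

Lemma integral_cst_cube (B r : R) (c : E) : 0 <= r -> cube c r `<=` D ->
  (\int[lebesgue_rV R n]_(x in D) (B ^+ 2 * \1_(cube c r) x)%:E = (B ^+ 2 * (2 * r) ^+ n)%:E)%E.
Proof.
move=> r0 cD.
under eq_integral do rewrite EFinM.
rewrite ge0_integralZl_EFin ?sqr_ge0//; last first.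
  by apply/measurable_EFinP/measurable_indic; exact: measurable_cube.
rewrite integral_indic//; last exact: measurable_cube.
by rewrite (setIidl cD) [RHS]EFinM; congr (_ * _)%E; exact: lebesgue_cube.
Qed.

Lemma dotp_ge_cube u B r c : L2 D u -> 0 <= r -> 0 <= B -> cube c r `<=` D ->
  (forall x, cube c r x -> B <= u x) -> B ^+ 2 * (2 * r) ^+ n <= dotp D u u.
Proof.
move=> Lu r0 B0 cD Bu; rewrite -lee_fin -sqnormE// -(integral_cst_cube B r0 cD).
apply: ge0_le_integral => //.
- by move=> x _; rewrite lee_fin mulr_ge0 ?sqr_ge0.
- apply/measurable_EFinP; apply: measurable_funM => //.
  by apply: measurable_indic; exact: measurable_cube.
- by apply/measurable_EFinP; apply: measurable_funX; case: Lu.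
- move=> x _; rewrite lee_fin indicE; have [/set_mem cx|_] := boolP (x \in cube c r).
    by rewrite mulr1 lerXn2r// ?nnegrE ?Bu// (le_trans B0)// Bu.
  by rewrite mulr0 sqr_ge0.
Qed.

Lemma dotp_le_cube u B r c : L2 D u -> 0 <= r -> cube c r `<=` D ->
  (forall x, cube c r x -> `|u x| <= B) -> (forall x, ~ cube c r x -> u x = 0) ->
  dotp D u u <= B ^+ 2 * (2 * r) ^+ n.
Proof.
move=> Lu r0 cD uB u0; rewrite -lee_fin -sqnormE// -(integral_cst_cube B r0 cD).
apply: ge0_le_integral => //.
- by move=> x _; rewrite lee_fin sqr_ge0.
- by apply/measurable_EFinP; apply: measurable_funX; case: Lu.
- apply/measurable_EFinP; apply: measurable_funM => //.
  by apply: measurable_indic; exact: measurable_cube.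
- move=> x _; rewrite lee_fin indicE; have [/set_mem cx|cx] := boolP (x \in cube c r).
    by rewrite mulr1 -real_normK ?num_real// lerXn2r ?nnegrE ?(le_trans _ (uB _ cx)) ?uB.
  by rewrite u0 ?expr0n ?mulr0//; move/negP: cx; apply: contra_not => /mem_set.
Qed.

End bump_facts.

Section rayleigh.
Context {R : realType} {n m : nat}.
Local Notation E := 'rV[R]_n.
Variables (X : 'I_m -> E -> E) (W Omega : set E).
Hypothesis oW : open W.
Hypothesis sX : forall j, smooth_vector_field W (X j).
Hypothesis oOmega : open Omega.
Hypothesis cOmega : compact (closure Omega).
Hypothesis OmegaW' : closure Omega `<=` W.
Let OmegaW : Omega `<=` W. Proof. exact: subset_trans (@subset_closure _ Omega) OmegaW'. Qed.
Let mW : measurable W. Proof. exact: open_measurable_rV. Qed.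
Let mO : measurable Omega. Proof. exact: open_measurable_rV. Qed.

Definition small_bump (c : E) (r : R) : E -> R := rescale r^-1 c (@bump R n).

Lemma small_bump_off c r x : 0 < r -> ~ cube c r x -> small_bump c r x = 0.
Proof.
move=> r0 cx; apply: bump_off => h; apply: cx => i; have := h i.
rewrite !mxE subr0 normrM ger0_norm ?invr_ge0 ?(ltW r0)//.
by rewrite ltr_pdivrMl// mulr1.
Qed.

Lemma small_bump_test (c : E) r : 0 < r ->
  [set x : E | forall i, `|x ord0 i - c ord0 i| <= r] `<=` Omega ->
  test_function Omega (small_bump c r).
Proof.
move=> r0 cO; apply/test_functionP; split; first exact/smooth_rescale/bump_smooth.
exists [set x : E | forall i, `|x ord0 i - c ord0 i| <= r]; split => //.
  exact: compact_closed_cube.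
by move=> x xK; apply: small_bump_off => // cx; apply: xK => i; exact/ltW/cx.
Qed.

Lemma vector_fields_bounded : exists2 M, 0 < M &
  forall j k x, Omega x -> `|X j x ord0 k| <= M.
Proof.
have h (p : 'I_m * 'I_n) : exists M, 0 < M /\ forall x, Omega x -> `|X p.1 x ord0 p.2| <= M.
  have [M M0 hM] := @continuous_bounded_on R _ _ (fun x => X p.1 x ord0 p.2) cOmega
    (fun x xO => (@sX p.1 p.2 [::] x (OmegaW' xO)).1).
  by exists M; split => // x Ox; apply: hM; exact: subset_closure.
have [M hM] := choice h.
exists (1 + \sum_p M p).
  by rewrite ltr_pwDl// sumr_ge0// => p _; apply: ltW; exact: (hM p).1.
move=> j k x Ox; apply: (le_trans ((hM (j, k)).2 x Ox)).
rewrite (bigD1 (j, k))//= addrCA lerDl.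
by rewrite addr_ge0// sumr_ge0// => p _; apply: ltW; exact: (hM p).1.
Qed.

(** If M bounds the coefficients of X on Omega, and K the partial derivatives
   of the bump, then |X_j phi| <= n M K / r on a cube of radius 2 r, while phi is
   bounded below by kap on a cube of radius d r. The powers r^n coming from the
   volumes cancel out. *)
Lemma small_bump_rayleigh : exists2 A, 0 < A & forall c r, 0 < r ->
  cube c (2 * r) `<=` Omega ->
  0 < dotp Omega (small_bump c r) (small_bump c r) /\
  dotp Omega (sum_adj_sq X (small_bump c r)) (small_bump c r) <=
    A / r ^+ 2 * dotp Omega (small_bump c r) (small_bump c r).
Proof.
have [M M0 hM] := vector_fields_bounded.
have [K K0 hK] := @bump_partial_bounded R n.
have [d' d'0 [kap kap0 hkap']] := @bump_lower_bound R n.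
pose d := Num.min d' 1.
have d0 : 0 < d by rewrite lt_min d'0 ltr01.
have d1 : d <= 1 by rewrite ge_min lexx orbT.
have hkap x : cube 0 d x -> kap <= @bump R n x.
  by move=> xd; apply: hkap' => i; apply: lt_le_trans (xd i) _; rewrite ge_min lexx.
pose A0 := m%:R * (n%:R * (M * K)) ^+ 2 * (2 / d) ^+ n / kap ^+ 2.
have A0_ge0 : 0 <= A0.
  have p0 : 0 <= (2 / d) ^+ n by apply: exprn_ge0; apply: divr_ge0 => //; exact: ltW.
  by rewrite /A0 divr_ge0 ?sqr_ge0// mulr_ge0// mulr_ge0 ?sqr_ge0.
exists (1 + A0); first by rewrite ltr_pwDl.
move=> c r r0 cO.
have r2 : r < 2 * r by lra.
have tb : test_function Omega (small_bump c r).
  by apply: small_bump_test => //; apply: subset_trans cO; exact: closed_cube_cube.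
have low : kap ^+ 2 * (2 * (d * r)) ^+ n <= dotp Omega (small_bump c r) (small_bump c r).
  apply: (dotp_ge_cube mO (test_L2 mO tb) _ (ltW kap0)).
  - by rewrite mulr_ge0// ltW.
  - apply: subset_trans cO => x xc i; apply: lt_le_trans (xc i) _.
    by apply: (@le_trans _ _ (1 * r)); [rewrite ler_pM2r|rewrite mul1r ltW].
  - move=> x xc; apply: hkap => i; rewrite !mxE subr0 normrM ger0_norm ?invr_ge0 ?(ltW r0)//.
    by rewrite ltr_pdivrMl// mulrC; exact: xc.
have low0 : 0 < kap ^+ 2 * (2 * (d * r)) ^+ n by rewrite mulr_gt0 ?exprn_gt0 ?mulr_gt0.
split; first exact: lt_le_trans low0 low.
rewrite (test_energy oW sX OmegaW tb).
have up j : dotp W (vf_apply (X j) (small_bump c r)) (vf_apply (X j) (small_bump c r)) <=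
    (n%:R * (M * K) / r) ^+ 2 * (2 * (2 * r)) ^+ n.
  have tX := test_vf_apply oW OmegaW (sX j) tb.
  apply: (dotp_le_cube mW (test_L2 mW tX)).
  - by rewrite mulr_ge0// ltW.
  - exact: (subset_trans cO OmegaW).
  - move=> x xc; rewrite (vf_applyE _ _ tb).
    apply: (le_trans (ler_norm_sum _ _ _)).
    rewrite -mulrA mulr_natl -[X in _ *+ X](card_ord n) -sumr_const.
    apply: ler_sum => k _; rewrite (rescale_partial _ _ _ _ (@bump_smooth R n)).2.
    rewrite !normrM -mulrA ler_pM//; first exact/hM/cO.
    rewrite mulrC ler_pM//; first exact: hK.
    by rewrite ger0_norm// invr_ge0 ltW.
  - move=> x xc; rewrite (vf_applyE _ _ tb) big1// => k _.
    rewrite (@partial_off _ _ [set x : E | forall i, `|x ord0 i - c ord0 i| <= r]) ?mulr0//.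
    + by apply: rV_compact_closed; exact: compact_closed_cube.
    + by move=> y yK; apply: small_bump_off => // cy; apply: yK => i; exact/ltW/cy.
    + by move=> xK; apply: xc; exact: (closed_cube_cube r2 xK).
apply: (@le_trans _ _ (\sum_(j < m) (n%:R * (M * K) / r) ^+ 2 * (2 * (2 * r)) ^+ n)).
  by apply: ler_sum => j _; exact: up.
rewrite sumr_const card_ord -mulr_natl.
apply: (@le_trans _ _ (A0 / r ^+ 2 * (kap ^+ 2 * (2 * (d * r)) ^+ n))).
  rewrite le_eqVlt; apply/orP; left; apply/eqP.
  have -> : (2 * (2 * r)) ^+ n = (2 / d) ^+ n * (2 * (d * r)) ^+ n.
    by rewrite -exprMn; congr (_ ^+ _); field; rewrite gt_eqF.
  rewrite /A0; move: ((2 / d) ^+ n) ((2 * (d * r)) ^+ n) => p q.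
  by field; rewrite !gt_eqF.
apply: ler_pM => //.
- by rewrite divr_ge0 ?sqr_ge0.
- exact: ltW.
- by rewrite ler_pM2r ?invr_gt0 ?exprn_gt0// lerDr.
Qed.

(** Locality makes the functions with disjoint supports orthogonal for the
   energy. *)
Lemma sum_adj_sq_local (U : set E) phi x : open U -> U x ->
  (forall y, U y -> phi y = 0) -> sum_adj_sq X phi x = 0.
Proof.
move=> oU Ux phi0; rewrite /sum_adj_sq big1// => j _.
rewrite /vf_adjoint big1 ?oppr0// => k _.
rewrite (@partial_eq_on _ _ U _ (cst 0))//; first exact: derive_cst.
move=> y Uy; rewrite /vf_apply (@near_eq_derive _ _ _ phi (cst 0)) ?derive_cst ?mulr0//.
exact: near_open oU Uy phi0.
Qed.

End rayleigh.

(** * L^2 as a module *)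

Section L2_type.
Context {R : realType} {n : nat}.
Local Notation E := 'rV[R]_n.

(** The proof that D is measurable is part of the predicate, so that the module
   structure can be inferred from the type. *)
Definition L2_pred (D : set E) (mD : measurable D) : {pred E -> R} :=
  [pred f | `[< L2 D f >]].

Lemma L2_predP D (mD : measurable D) f : reflect (L2 D f) (f \in L2_pred mD).
Proof. exact: asboolP. Qed.

Lemma L2_submod_closed D (mD : measurable D) : submod_closed (L2_pred mD).
Proof.
split; first by apply/L2_predP; exact: L2_cst0.
by move=> a u v /L2_predP Lu /L2_predP Lv; apply/L2_predP; exact: L2_linear.
Qed.

HB.instance Definition _ D (mD : measurable D) :=
  GRing.isSubmodClosed.Build R (E -> R) (L2_pred mD) (L2_submod_closed mD).

Record L2_fun D (mD : measurable D) := L2Fun {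
  L2_val :> E -> R;
  L2_valP : L2_val \in L2_pred mD }.

HB.instance Definition _ D (mD : measurable D) := [isSub for @L2_val D mD].
HB.instance Definition _ D (mD : measurable D) := [Choice of L2_fun mD by <:].
HB.instance Definition _ D (mD : measurable D) :=
  [SubChoice_isSubLmodule of L2_fun mD by <:].

Lemma L2_funP D (mD : measurable D) (u : L2_fun mD) : L2 D u.
Proof. exact/L2_predP/L2_valP. Qed.

Definition L2_mk D (mD : measurable D) (f : E -> R) (Lf : L2 D f) : L2_fun mD :=
  L2Fun (introT (L2_predP mD f) Lf).

End L2_type.

(** * Packing disjoint cubes *)

Section counting.
Context {R : realType} {n : nat}.
Local Notation E := 'rV[R]_n.

Lemma grid_of_cubes (p : E) (e : R) (N : nat) : 0 < e -> (0 < N)%N ->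
  exists c : {ffun 'I_n -> 'I_N} -> E,
    (forall a, cube (c a) (2 * (e / 2 / N%:R)) `<=` cube p e) /\
    (forall a b x, a != b -> cube (c a) (e / 2 / N%:R) x -> ~ cube (c b) (e / 2 / N%:R) x).
Proof.
move=> e0 N0; have N0' : 0 < N%:R :> R by rewrite ltr0n.
set r := e / 2 / N%:R.
have r0 : 0 < r by rewrite !divr_gt0.
have rN : r * N%:R = e / 2 by rewrite divfK// gt_eqF.
(* the centers p - e / 2 + (2 a_i + 1) r of a regular subdivision *)
pose c (a : {ffun 'I_n -> 'I_N}) : E :=
  \row_i (p ord0 i - e / 2 + (2 * (r * (a i)%:R) + r)).
have bnd (k : 'I_N) : 0 <= r * k%:R /\ r * k%:R + r <= e / 2.
  split; first by rewrite mulr_ge0// ltW.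
  by rewrite -rN -[X in _ + X]mulr1 -mulrDr natr1 ler_pM2l// ler_nat.
exists c; split.
- move=> a x xc i; have := xc i; rewrite !mxE !ltr_distl.
  have [] := bnd (a i); have e2 : e = 2 * (e / 2) by rewrite mulrC divfK.
  move: (r * (a i)%:R) (e / 2) e2 => q h -> q0 qh /andP[x1 x2].
  by apply/andP; split; lra.
- move=> a b x /eqP ab xa xb; apply: ab; apply/ffunP => i; apply/val_inj.
  have := xa i; have := xb i; rewrite !mxE !ltr_distl.
  move=> /andP[b1 b2] /andP[a1 a2].
  have sep (j k : 'I_N) : (j < k)%N -> r * j%:R + r <= r * k%:R.
    by move=> jk; rewrite -[X in _ + X]mulr1 -mulrDr natr1 ler_pM2l// ler_nat.
  case: (ltngtP (a i) (b i)) => // /sep ab; move: a1 a2 b1 b2 ab;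
    move: (r * (a i)%:R) (r * (b i)%:R) => q q' *; exfalso; lra.
Qed.

(** Take N least such that k < N^d. Then N >= 2, so N <= 2 (N - 1), and
   (N - 1)^d <= k by minimality. *)
Lemma least_grid_size (d k : nat) : (0 < d)%N -> (0 < k)%N -> exists N : nat,
  [/\ (0 < N)%N, (k < N ^ d)%N & (N%:R : R) ^+ 2 <= 4 * k%:R `^ (2 / d%:R)].
Proof.
move=> d0 k0.
have exN : exists N, (k < N ^ d)%N.
  by exists k.+1; rewrite -{1}(expn1 k.+1) leq_exp2l.
pose N := ex_minn exN.
have [kN minN] : (k < N ^ d)%N /\ forall N', (k < N' ^ d)%N -> (N <= N')%N.
  by rewrite /N; case: ex_minnP.
have N_gt1 : (1 < N)%N.
  rewrite ltnNge; apply/negP => N1; move: kN; rewrite ltnNge => /negP; apply.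
  by apply: (@leq_trans (1 ^ d)); [rewrite leq_exp2r|rewrite exp1n].
exists N; split => //; first exact: ltnW.
have predN : (N.-1 ^ d <= k)%N.
  by rewrite leqNgt; apply/negP => /minN; rewrite leqNgt prednK ?leqnn// ltnW.
have le1 : (N.-1%:R : R) ^+ 2 <= k%:R `^ (2 / d%:R).
  have d0' : d%:R != 0 :> R by rewrite pnatr_eq0 -lt0n.
  have -> : (N.-1%:R : R) ^+ 2 = (N.-1 ^ d)%:R `^ (2 / d%:R).
    by rewrite natrX -(powR_mulrn d)// -powRrM mulrC divfK// powR_mulrn.
  by apply: ge0_ler_powR; rewrite ?nnegrE ?divr_ge0// ler_nat.
apply: (@le_trans _ _ (4 * N.-1%:R ^+ 2)); last by rewrite ler_pM2l.
rewrite (_ : 4 * _ = (2 * N.-1%:R) ^+ 2); last by ring.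
rewrite lerXn2r ?nnegrE ?mulr_ge0// -natrM ler_nat.
by case: N N_gt1 {kN minN predN le1} => [|[|N]]// _; rewrite /= mul2n -addnn addSn ltnS leq_addl.
Qed.

End counting.

(** * Min-max for the Dirichlet operator and the eigenvalue bound *)

Section spectrum.
Context {R : realType} {n m : nat}.
Local Notation E := 'rV[R]_n.
Variables (X : 'I_m -> E -> E) (W Omega : set E).
Hypothesis oW : open W.
Hypothesis sX : forall j, smooth_vector_field W (X j).
Hypothesis oOmega : open Omega.
Hypothesis OmegaW : Omega `<=` W.
Let mO : measurable Omega. Proof. exact: open_measurable_rV. Qed.
Local Notation H := (L2_fun mO).

Definition L2_ip (u v : H) : R := dotp Omega u v.

Definition dirichlet_graph (u f : H) := dirichlet_operator X W Omega u f.

Lemma L2_ip_linear a (u v w : H) : L2_ip (a *: u + v) w = a * L2_ip u w + L2_ip v w.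
Proof. by rewrite -dotp_linear//; exact: L2_funP. Qed.

Lemma L2_ip_sym (u v : H) : L2_ip u v = L2_ip v u.
Proof. exact: dotpC. Qed.

Lemma L2_ip_ge0 (u : H) : 0 <= L2_ip u u.
Proof. exact: dotp_ge0. Qed.

Lemma L2_ip_complete (x : nat -> H) (C theta : R) : 0 <= theta < 1 ->
  (forall j, L2_ip (x j - x j.+1) (x j - x j.+1) <= C * theta ^+ j) ->
  exists w, L2_ip (x j - w) (x j - w) @[j --> \oo] --> (0 : R).
Proof.
move=> theta01 hx.
have [w Lw xw] := L2_complete mO theta01 (fun j => L2_funP (x j)) hx.
by exists (L2_mk mO Lw).
Qed.

Lemma dirichlet_graph_linear a (u f v g : H) : dirichlet_graph u f -> dirichlet_graph v g ->
  dirichlet_graph (a *: u + v) (a *: f + g).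
Proof. by move=> uf vg; exact: (dirichlet_linear oW sX oOmega OmegaW a uf vg). Qed.

Lemma dirichlet_graph_sym (u f v g : H) : dirichlet_graph u f -> dirichlet_graph v g ->
  L2_ip f v = L2_ip u g.
Proof. by move=> uf vg; exact: (dirichlet_sym oW sX oOmega OmegaW uf vg). Qed.

Lemma dirichlet_graph_null (u f g : H) : dirichlet_graph u f ->
  L2_ip (f - g) (f - g) = 0 -> dirichlet_graph u g.
Proof.
move=> uf fg; exact: (dirichlet_null oOmega uf (L2_funP g) fg).
Qed.

Lemma resolvent_set_resolvent t : resolvent_set X W Omega t ->
  resolvent L2_ip dirichlet_graph t.
Proof.
move=> [surj [C hC]]; split.
  move=> f; have [u hu] := surj f (L2_funP f).
  have Lu : L2 Omega u := dirichlet_L2 oW oOmega OmegaW hu.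
  by exists (L2_mk mO Lu).
exists C => u f uf; have := hC _ _ uf.
have Lft := L2_funP (f - t *: u).
by rewrite (sqnormE mO (L2_funP u)) (sqnormE mO Lft) -EFinM lee_fin.
Qed.

(** As mu occurs in lam as many times as the dimension of its eigenspace, a
   basis of the latter can be indexed by the j such that lam j = mu. *)
Lemma eigenbasis (lam : nat -> R) mu :
  (exists2 d, ([set k | lam k = mu] #= `I_d)%card &
     has_dim Omega (eigenspace_of X W Omega mu) d) ->
  exists V : nat -> H, forall u w : H, eigenvector dirichlet_graph mu w ->
    (forall j, lam j = mu -> L2_ip u (V j) = 0) -> L2_ip u w = 0.
Proof.
move=> [d /card_set_bijP[f fbij] [e [Ve _ span]]].
have Le i : L2 Omega (e i) := dirichlet_L2 oW oOmega OmegaW (Ve i).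
(* the default value 0 is only used at indices j with lam j != mu *)
pose V j : H := if insub (f j) is Some i then L2_mk mO (Le i) else 0.
exists V => u w Gw orth.
have orth_e i : dotp Omega u (e i) = 0.
  have [_ _ surj] := fbij.
  have [j jmu fj] := surj i (ltn_ord i).
  have := orth j jmu; rewrite /V fj valK.
  by [].
have [c wc] := span w Gw.
have Lsum : L2 Omega (fun x => \sum_(i < d) c i * e i x).
  apply: (L2_sum mO) => i.
  have := L2_linear mO (c i) (Le i) (L2_cst0 Omega).
  by congr (L2 _ _); apply/funext => x; rewrite addr0.
rewrite /L2_ip dotpC (dotp_ae mO (L2_funP w) Lsum (L2_funP u) wc).
rewrite dotp_sum_l//; last 2 first.
- move=> i; have := L2_linear mO (c i) (Le i) (L2_cst0 Omega).
  by congr (L2 _ _); apply/funext => x; rewrite addr0.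
- exact: L2_funP.
rewrite big1// => i _.
have := dotp_linear mO (c i) (Le i) (L2_cst0 Omega) (L2_funP u).
rewrite [dotp _ (e i) _]dotpC orth_e mulr0 add0r => h.
transitivity (dotp Omega (fun x => c i * e i x + 0) u).
  by congr dotp; apply/funext => x; rewrite addr0.
rewrite h /dotp; transitivity (\int[lebesgue_rV R n]_(x in Omega) (cst 0 x : R)).
  by apply: eq_Rintegral => x _; rewrite mul0r.
by rewrite Rintegral_cst// mul0r.
Qed.

Lemma dirichlet_minmax (lam : nat -> R) (M : R) k (phi : 'I_k.+1 -> E -> R) :
  dirichlet_eigenvalues X W Omega lam ->
  (forall i, test_function Omega (phi i)) ->
  (forall i, 0 < dotp Omega (phi i) (phi i)) ->
  (forall i, dotp Omega (sum_adj_sq X (phi i)) (phi i) <=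
     M * dotp Omega (phi i) (phi i)) ->
  (forall i j, i != j -> exists U : set E, [/\ open U,
     forall x, U x -> phi i x = 0 & forall x, ~ U x -> phi j x = 0]) ->
  lam k <= M.
Proof.
move=> [lam0 lam_homo _ specE mult] tphi phi_gt0 phi_le disj.
have [V hV] := choice (fun mu => eigenbasis (mult mu)).
have Lphi i := test_L2 mO (tphi i).
have LA i := test_L2 mO (test_sum_adj_sq oW sX OmegaW (tphi i)).
have zero_dotp (f g : E -> R) : (forall x, f x * g x = 0) -> dotp Omega f g = 0.
  move=> fg; transitivity (\int[lebesgue_rV R n]_(x in Omega) (cst 0 x : R)).
    by apply: eq_Rintegral => x _; rewrite fg.
  by rewrite Rintegral_cst// mul0r.
apply: (@minmax_upper R H L2_ip L2_ip_linear L2_ip_sym L2_ip_ge0 dirichlet_graph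
  dirichlet_graph_linear dirichlet_graph_sym dirichlet_graph_null L2_ip_complete
  lam M k (fun i => L2_mk mO (Lphi i)) (fun i => L2_mk mO (LA i))
  (fun j => V (lam j) j)) => //.
- move=> t ht; apply: resolvent_set_resolvent; apply: contrapT => tres.
  have : dirichlet_spectrum X W Omega t by [].
  by rewrite specE => -[j _ jt]; have := ht j; rewrite jt eqxx.
- move=> u mu w /andP[_ mu_lt] Gw orth; apply: (hV mu) Gw _ => j jmu.
  rewrite -jmu; apply: orth; rewrite ltnNge; apply/negP => kj.
  by have := lam_homo _ _ kj; rewrite jmu leNgt mu_lt.
- by move=> i; exact: (test_dirichlet oW sX oOmega OmegaW (tphi i)).
- move=> i j ij; apply: zero_dotp => x; have [U [oU Ui Uj]] := disj i j ij.
  have [Ux|Ux] := pselect (U x); first by rewrite /= Ui// mul0r.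
  by rewrite /= Uj// mulr0.
- move=> i j ij; apply: zero_dotp => x; have [U [oU Ui Uj]] := disj i j ij.
  have [Ux|Ux] := pselect (U x); last by rewrite /= Uj// mulr0.
  by rewrite /= (sum_adj_sq_local X oU Ux Ui) mul0r.
Qed.

End spectrum.

Theorem theorem1p4 (R : realType) (n m Q : nat) (W Omega : set 'rV[R]_n)
    (X : 'I_m -> 'rV[R]_n -> 'rV[R]_n)
    (n_ge2 : (2 <= n)%N)
    (W_open : open W) (W_connected : connected W)
    (X_smooth : forall j, smooth_vector_field W (X j))
    (X_hormander : hormander_condition X W)
    (Omega_open : open Omega) (Omega_connected : connected Omega)
    (Omega_compact : compact (closure Omega)) (Omega_W : closure Omega `<=` W)
    (Omega_smooth : smooth_boundary Omega)
    (Omega_nonchar : non_characteristic X Omega)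
    (Q_index : hormander_index X (closure Omega) Q) (Q_ge2 : (2 <= Q)%N) :
  exists2 C : R, 0 < C &
    forall lam : nat -> R, dirichlet_eigenvalues X W Omega lam ->
    forall k : nat, (1 <= k)%N ->
      lam k.-1 <= C * (k%:R - 1) `^ (2 / n%:R) + lam 0%N.
Proof.
have n_gt0 : (0 < n)%N by exact: ltnW.
have [p Omega_p] : Omega !=set0.
  apply: contrapT => /nonemptyPn Omega0; move: Q_ge2; rewrite leqNgt => /negP; apply.
  apply: (@leq_ltn_trans 0) => //; apply: Q_index.2 => x.
  by rewrite Omega0 closure0.
have [e e_gt0 e_Omega] := (nbhs_cubeP p Omega).1 (open_nbhs_nbhs (conj Omega_open Omega_p)).
have Omega_sub : Omega `<=` W by exact: subset_trans (@subset_closure _ Omega) Omega_W.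
have [A A_gt0 hA] := small_bump_rayleigh W_open X_smooth Omega_open Omega_compact Omega_W.
exists (4 * A / (e / 2) ^+ 2); first by rewrite !mulr_gt0 ?invr_gt0 ?exprn_gt0 ?divr_gt0.
move=> lam lam_ev [//|k] _; rewrite -[k.+1%:R]natr1 addrK /=.
have lam0_gt0 : 0 < lam 0%N by case: lam_ev.
have [->|k_neq0] := eqVneq k 0%N.
  by rewrite lerDr mulr_ge0 ?powR_ge0// ltW// !mulr_gt0 ?invr_gt0 ?exprn_gt0 ?divr_gt0.
have [N [N_gt0 k_lt N_le]] := @least_grid_size R n k n_gt0 (ltac:(by rewrite lt0n)).
have [c [c_sub c_disj]] := @grid_of_cubes R n p e N e_gt0 N_gt0.
set r := e / 2 / N%:R in c_sub c_disj.
have r_gt0 : 0 < r by rewrite !divr_gt0// ltr0n.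
have card_grid : #|{ffun 'I_n -> 'I_N}| = (N ^ n)%N by rewrite card_ffun !card_ord.
pose pos (i : 'I_k.+1) : {ffun 'I_n -> 'I_N} :=
  enum_val (cast_ord (esym card_grid) (widen_ord k_lt i)).
have pos_inj : injective pos.
  by move=> i j /enum_val_inj/cast_ord_inj/(congr1 val)/= ij; exact/val_inj.
pose phi i := small_bump (c (pos i)) r.
have sub i : cube (c (pos i)) (2 * r) `<=` Omega by exact: subset_trans (c_sub _) e_Omega.
have r2 : r < 2 * r by rewrite mulr2n mulrDl mul1r ltrDl.
have : lam k <= A / r ^+ 2.
  apply: (@dirichlet_minmax _ _ _ X W Omega W_open X_smooth Omega_open Omega_sub
    lam _ k phi lam_ev).
  - move=> i; apply: small_bump_test => //.
    by apply: subset_trans (sub i); exact: closed_cube_cube.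
  - by move=> i; have [] := hA _ _ r_gt0 (sub i).
  - by move=> i; have [] := hA _ _ r_gt0 (sub i).
  - move=> i j ij; exists (cube (c (pos j)) r); split; first exact: open_cube.
      move=> x xj; apply: small_bump_off => // xi; apply: c_disj xi xj.
      by apply: contra ij => /eqP/pos_inj ->.
    by move=> x xj; exact: small_bump_off.
move=> lam_le; apply: (le_trans lam_le); apply: (@le_trans _ _ (4 * A / (e / 2) ^+ 2 * k%:R `^ (2 / n%:R))).
  have -> : A / r ^+ 2 = A / (e / 2) ^+ 2 * N%:R ^+ 2.
    by rewrite /r; field; rewrite !gt_eqF// ltr0n.
  rewrite (_ : 4 * A / _ * _ = A / (e / 2) ^+ 2 * (4 * k%:R `^ (2 / n%:R))); last by ring.
  by rewrite ler_pM2l// divr_gt0// exprn_gt0// divr_gt0.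
by rewrite lerDl ltW.
Qed.
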